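(* Fix an integer $n \ge 2$ and let $G$ be a subgroup of $S_n$ (considered up to conjugacy in $S_n$). Let $K_{\mathfrak p}$ range over finite extensions of $p$-adic fields $\mathbb{Q}_p$, where the prime $p$ and the residue degree $f$ may both vary in any way, such that the order $q = p^f$ of the residue field of $K_{\mathfrak p}$ tends to infinity. Then $$\nu_{n,\mathfrak p}\left(P^{*}_{n,\mathfrak p}(G)\right) \to \tilde{\nu}_n(G) \quad \text{as } q \to \infty.$$
   Context: For a finite extension $K_{\mathfrak p}$ of $\mathbb{Q}_p$, $\mathfrak{O}_{\mathfrak p}$ is its ring of integers, $\mathfrak p$ the maximal ideal, and $\mathbb{F}_q=\mathfrak{O}_{\mathfrak p}/\mathfrak p$ the residue field. Let $h_{\mathfrak p}$ be the additive Haar measure on $\mathfrak{O}_{\mathfrak p}$ with total mass $1$, and let $\nu_{n,\mathfrak p}$ be the product measure $h_{\mathfrak p}^{\otimes n}$ on $(\mathfrak{O}_{\mathfrak p})^n$. A tuple $(a_0,\dots,a_{n-1}) \in (\mathfrak{O}_{\mathfrak p})^n$ is identified with the monic polynomial $f(x) = x^n + a_{n-1}x^{n-1} + \cdots + a_0$. For $f$ with distinct roots, let $K_f$ be its splitting field over $K_{\mathfrak p}$ and $G_f = \mathrm{Gal}(K_f/K_{\mathfrak p})$. An ordering of the roots realizes $G_f$ as a subgroup of $S_n$, well defined up to conjugation. For a subgroup $G \subset S_n$, $P^{*}_{n,\mathfrak p}(G)$ is the set of tuples whose polynomial $f$ has discriminant not divisible by $\mathfrak p$ (so in particular has distinct roots)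 and for which $G_f$ is conjugate in $S_n$ to $G$. For a partition $\mu = (\mu_1 \ge \cdots \ge \mu_k\ge 1)$ of $n$, $C_\mu \subset S_n$ is the conjugacy class of permutations with cycle lengths $\mu_1,\dots,\mu_k$ (fixed points included), and $\nu_n(\mu) = |C_\mu|/n!$. The Erdős–Turán distribution $\tilde{\nu}_n$ is defined as follows: if $G \subset S_n$ is cyclic, let $\mu_G$ be the partition such that for every $\sigma \in C_{\mu_G}$ the group $\langle \sigma \rangle$ is conjugate to $G$ (i.e. the cycle type of a generator of $G$), and set $\tilde{\nu}_n(G) = \nu_n(\mu_G)$; if $G$ is non-cyclic, set $\tilde{\nu}_n(G) = 0$. Convergence as $q \to \infty$ means: for every $\varepsilon>0$ there is $q_0$ such that the quantity is within $\varepsilon$ of the limit for every prime $p$ and every finite extension $K_{\mathfrak p}/\mathbb{Q}_p$ with residue field of order $q \ge q_0$. *)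

(* Defs.v *)
From HB Require Import structures.
From mathcomp Require Import all_boot all_order all_fingroup all_algebra.
From mathcomp Require Import all_solvable all_field.
From mathcomp Require Import all_classical all_reals all_analysis.

Set Implicit Arguments.
Unset Strict Implicit.
Unset Printing Implicit Defensive.

Import Order.TTheory GRing.Theory Num.Theory.

Local Open Scope classical_set_scope.
Local Open Scope ring_scope.

Record nonarch_abs (R : realType) (K : fieldType) := NonarchAbs {
  vabs :> K -> R ;
  vabs_ge0 : forall x, 0 <= vabs x ;
  vabs_eq0 : forall x, vabs x = 0 <-> x = 0 ;
  vabsM : forall x y, vabs (x * y) = vabs x * vabs y ;
  vabs_ultra : forall x y, vabs (x + y) <= Num.max (vabs x) (vabs y) }.

Section AbsTheory.
Context (R : realType) (K : fieldType) (v : nonarch_abs R K).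

Lemma nabs0 : v 0 = 0. Proof. exact/vabs_eq0. Qed.

Lemma nabs1 : v 1 = 1.
Proof.
have v1 : v 1 != 0 by apply/eqP => /vabs_eq0/eqP; rewrite oner_eq0.
by apply: (mulfI v1); rewrite -vabsM !mulr1.
Qed.

Lemma nabsN x : v (- x) = v x.
Proof.
suff v1 : v (- 1) = 1 by rewrite -mulN1r vabsM v1 mul1r.
have : v (-1) ^+ 2 == 1 by rewrite expr2 -vabsM mulrNN mulr1 nabs1.
rewrite sqrf_eq1 => /orP[/eqP//|/eqP v1].
by have := vabs_ge0 v (-1); rewrite v1 oppr_ge0 ler10.
Qed.

Lemma nabs_distC x y : v (x - y) = v (y - x).
Proof. by rewrite -opprB nabsN. Qed.

Lemma nabs_dist0 x y : v (x - y) = 0 -> x = y.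
Proof. by move/vabs_eq0/eqP; rewrite subr_eq0 => /eqP. Qed.

Lemma nabs_triangle y x z : v (x - z) <= v (x - y) + v (y - z).
Proof.
rewrite -(subrKA y); apply: le_trans (vabs_ultra _ _ _) _.
by rewrite ge_max lerDl lerDr !vabs_ge0.
Qed.

End AbsTheory.

(* [valued v] is [K] with the metric |x - y|_v; the alias records [v], which
   cannot be inferred from the bare type [K]. *)
Definition valued (R : realType) (K : fieldType) (v : nonarch_abs R K) : Type :=
  K.

HB.instance Definition _ (R : realType) (K : fieldType) (v : nonarch_abs R K) :=
  GRing.Field.on (valued v).
HB.instance Definition _ (R : realType) (K : fieldType) (v : nonarch_abs R K) :=
  isPointed.Build (valued v) 0.
HB.instance Definition _ (R : realType) (K : fieldType) (v : nonarch_abs R K) :=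
  @isMetric.Build R (valued v) (fun x y => v (x - y))
    (fun x => etrans (congr1 v (subrr x)) (nabs0 v)) (@nabs_dist0 R K v)
    (@nabs_distC R K v) (@nabs_triangle R K v).

Definition padic_val (p : nat) (r : rat) : int :=
  (logn p `|numq r|%N)%:Z - (logn p `|denq r|%N)%:Z.

Definition padic_abs (R : realType) (p : nat) (r : rat) : R :=
  if r == 0 then 0 else p%:R ^ (- padic_val p r).

(* (Qp, v) is a completion of the field of rational numbers for the p-adic
   absolute value; this determines (Qp, v) up to a unique isomorphism. *)
Record is_padic_field (R : realType) (p : nat) (Qp : fieldType)
    (v : nonarch_abs R Qp) : Prop := IsPadicField {
  padic_field_abs : forall r : rat, v (ratr r) = padic_abs R p r ;
  padic_field_dense : dense (range (ratr : rat -> valued v)) ;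
  padic_field_complete : forall F : set_system (valued v),
    ProperFilter F -> cauchy F -> cvg F }.

Definition val_ring (R : realType) (K : fieldType) (v : nonarch_abs R K) :
  {pred K} := fun x => v x <= 1.

Section ValRing.
Context (R : realType) (K : fieldType) (v : nonarch_abs R K).

Fact val_ring_subring : subring_closed (val_ring v).
Proof.
split=> [|x y|x y]; rewrite !unfold_in ?nabs1// => vx vy.
  by apply: le_trans (vabs_ultra _ _ _) _; rewrite nabsN ge_max vx.
by rewrite vabsM mulr_ile1 ?vabs_ge0.
Qed.

HB.instance Definition _ :=
  GRing.isSubringClosed.Build K (val_ring v) val_ring_subring.

Record integers := Integer {
  int_val :> K ;
  int_valP : int_val \in val_ring v }.

HB.instance Definition _ := [isSub for int_val].
HB.instance Definition _ := [Choice of integers by <:].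
HB.instance Definition _ := [SubChoice_isSubComNzRing of integers by <:].

Definition max_ideal : {pred integers} := fun x => v (val x) < 1.

Fact max_ideal_idealr : idealr_closed max_ideal.
Proof.
split=> [||a x y]; rewrite !unfold_in ?rmorph0 ?rmorph1 ?nabs0 ?nabs1 ?ltr01//.
  by rewrite ltxx.
move=> vx vy; rewrite rmorphD rmorphM.
apply: le_lt_trans (vabs_ultra _ _ _) _; rewrite gt_max vy andbT vabsM.
by apply: le_lt_trans vx; rewrite ler_piMl ?vabs_ge0//; exact: int_valP.
Qed.

HB.instance Definition _ :=
  isIdealr.Build integers max_ideal max_ideal_idealr.

Definition residue_field : Type := {ideal_quot max_ideal}.

HB.instance Definition _ := GRing.ComNzRing.on residue_field.

HB.instance Definition _ := isPointed.Build integers 0.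
HB.instance Definition _ :=
  @isMetric.Build R integers (fun x y => v (val x - val y))
    (fun x => etrans (congr1 v (subrr (val x))) (nabs0 v))
    (fun x y e => val_inj (nabs_dist0 e))
    (fun x y => nabs_distC v (val x) (val y))
    (fun y x z => nabs_triangle v (val y) (val x) (val z)).

HB.instance Definition _ := Measurable.copy integers
  (g_sigma_algebraType (@open integers)).

End ValRing.

Arguments max_ideal {R K} v x.

Definition is_haar (R : realType) (K : fieldType) (v : nonarch_abs R K)
    (h : probability (integers v) R) : Prop :=
  forall (a : integers v) (A : set (integers v)), measurable A ->
    h [set a + x | x in A] = h A.

Definition cons_pair (T : Type) (n : nat) (x : T * n.-tuple T) : n.+1.-tuple T :=
  [tuple of x.1 :: x.2].

Section PowerMeasure.
Context d (T : measurableType d) (R : realType).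

Fact measurable_cons_pair n : measurable_fun [set: T * n.-tuple T]
  (@cons_pair T n).
Proof. exact: measurable_cons. Qed.

HB.instance Definition _ n := isMeasurableFun.Build _ _ _ _ (@cons_pair T n)
  (@measurable_cons_pair n).

Fixpoint power_measure (P : probability T R) (n : nat) :
    probability (n.-tuple T) R :=
  if n is m.+1 then distribution (P \x power_measure P m)%E (@cons_pair T m)
  else dirac [tuple].

End PowerMeasure.

Definition monic_of_tuple (A : comNzRingType) (n : nat) (a : n.-tuple A) :
  {poly A} := 'X^n + \sum_(i < n) tnth a i *: 'X^i.

(* Discriminant of a monic polynomial f of degree n, from the resultant:
   (-1)^(n(n-1)/2) Res(f, f'). The Sylvester matrix used by [resultant] has the
   expected size when n is nonzero in A, as in a ring of p-adic integers. *)
Definition monic_disc (A : comNzRingType) (f : {poly A}) : A :=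
  (-1) ^+ 'C((size f).-1, 2) * resultant f f^`().

Definition galois_perms (F : fieldType) (L : splittingFieldType F) (n : nat)
    (r : n.-tuple L) : {set 'S_n} :=
  [set s : 'S_n | [exists g in 'Gal({:L} / 1%AS)%g,
                    [forall i, g (tnth r i) == tnth r (s i)]]]%SET.

Definition has_galois_group (F : fieldType) (n : nat) (f : {poly F})
    (G : {group 'S_n}) : Prop :=
  exists (L : splittingFieldType F) (r : n.-tuple L),
    [/\ map_poly (in_alg L) f = \prod_(x <- r) ('X - x%:P),
        <<1 & r>>%VS = fullv &
        exists s : 'S_n, galois_perms r = (G :^ s)%g :> {set 'S_n}].

Definition Pstar (R : realType) (K : fieldType) (v : nonarch_abs R K) (n : nat)
    (G : {group 'S_n}) : set (n.-tuple (integers v)) :=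
  [set a | monic_disc (monic_of_tuple a) \notin max_ideal v /\
           has_galois_group (map_poly val (monic_of_tuple a)) G].

Arguments Pstar {R K} v {n} G.

Definition cycle_type (n : nat) (s : 'S_n) : seq nat :=
  sort geq [seq #|(c : {set 'I_n})| | c in porbits s].

Definition cycle_class (n : nat) (mu : seq nat) : {set 'S_n} :=
  [set s : 'S_n | cycle_type s == mu]%SET.

Definition nu_partition (R : realType) (n : nat) (mu : seq nat) : R :=
  #|cycle_class n mu|%:R / n`!%:R.

(* Generators of G all have the same cycle type, so the choice made by [pick]
   is irrelevant. *)
Definition erdos_turan (R : realType) (n : nat) (G : {group 'S_n}) : R :=
  if [pick s | generator G s] is Some s then nu_partition R n (cycle_type s)
  else 0.

(* Main.v *)
(* If the reduction of f is separable, Hensel's lemma puts the roots of f and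
   all conjugates of theta in K(theta), where theta is a root of a lift g of
   the minimal polynomial of a generator of the splitting field of the
   reduction.  Hence the Galois group of f is cyclic, generated by an element
   that permutes the roots of f as the Frobenius sigma permutes their
   residues, and f is counted for G iff <sigma> is conjugate to G.
   So Pstar G is a finite disjoint union of residue cylinders, each of measure
   q^-n, and one counts polynomials over F_q.  For a permutation s, the tuples
   x of distinct elements with x_i^q = x_(s i) number at most q^n, since x is
   determined by its value at one point of each cycle of s.  Summed over all s
   these numbers give n! times the number of separable polynomials, which is
   at least n! (q^n - n q^(n-1)), because an inseparable polynomial is
   divisible by a square.  Therefore each of them is q^n - O(q^(n-1)), and
   summing over the s with <s> conjugate to G gives the limit |T| / n!, where
   T, the set of these s, is the conjugacy class of a generator of G, or is
   empty when G is not cyclic. *)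
Require Import Defs.
From HB Require Import structures.
From mathcomp Require Import all_boot all_order all_fingroup all_algebra.
From mathcomp Require Import all_solvable all_field.
From mathcomp Require Import generic_quotient ring_quotient.
From mathcomp Require Import ring zify.
From mathcomp Require Import all_classical all_reals all_analysis.

Set Implicit Arguments.
Unset Strict Implicit.
Unset Printing Implicit Defensive.

Import Order.TTheory GRing.Theory Num.Theory.
Import numFieldNormedType.Exports.

Local Open Scope ring_scope.

(** * Hensel's lemma *)

Section Hensel.

Lemma horner_taylor2 (A : comNzRingType) (F : {poly A}) (x h : A) :
  exists w, F.[x + h] = F.[x] + F^`().[x] * h + h * h * w.
Proof.
elim/poly_ind: F => [|F c [w IHw]].
  by exists 0; rewrite deriv0 !horner0 mul0r mulr0 !addr0.
exists (F^`().[x] + w * (x + h)).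
by rewrite derivD derivM derivX derivC addr0 mulr1 !hornerE IHw; ring.
Qed.

Lemma hornerD_dvd (A : comNzRingType) (F : {poly A}) (x h : A) :
  exists w, F.[x + h] = F.[x] + h * w.
Proof.
have [w ->] := horner_taylor2 F x h; exists (F^`().[x] + h * w); ring.
Qed.

(** Separatedness and completeness for the powers of [c], stated by divisibility alone, so that they
    apply to a ring without a topology and pass coefficientwise to a quotient by a monic
    polynomial. *)
Definition cadic_separated (A : comNzRingType) (c : A) :=
  forall a : A, (forall m, exists b, a = c ^+ m * b) -> a = 0.

Definition cadic_complete (A : comNzRingType) (c : A) :=
  forall s : nat -> A, (forall m, exists r, s m.+1 = s m + c ^+ m * r) ->
  exists l, forall m, exists r, l = s m + c ^+ m * r.

(* Newton's iteration with the slope u frozen at a0 gains one power of c at each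
   step, which is all that c-adic completeness requires. *)
Lemma hensel (A : comNzRingType) (c : A) (F : {poly A}) (a0 u : A) :
  cadic_separated c -> cadic_complete c ->
  (exists b, F.[a0] = c * b) -> (exists b, u * F^`().[a0] = 1 + c * b) ->
  exists2 a, F.[a] = 0 & exists b, a = a0 + c * b.
Proof.
move=> sepA cplA [b0 Fa0] [e ue].
pose s m := iter m (fun a => a - u * F.[a]) a0.
have sP m : (exists b, F.[s m] = c ^+ m.+1 * b) /\ (exists b, s m = a0 + c * b).
  elim: m => [|m [[b Fb] [b' sb]]].
    by split; [exists b0; rewrite expr1 | exists 0; rewrite mulr0 addr0].
  split; last by exists (b' - u * c ^+ m * b); rewrite /= Fb sb exprS; ring.
  have [w1 dF] := hornerD_dvd F^`() a0 (c * b').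
  have [w2 FS] := horner_taylor2 F (s m) (- (u * F.[s m])).
  exists (- (e + u * b' * w1) * b + c ^+ m * u ^+ 2 * b ^+ 2 * w2).
  rewrite [s _]/= FS sb dF -sb Fb.
  (* The Newton step leaves [F.[s m]] times 1 minus [u] times the slope at [s m]. Both
     [1 - u * F^'(a0)] and [s m - a0] are multiples of [c], so one power is gained; the quadratic
     remainder carries [c ^+ (2m+2)]. *)
  transitivity (c ^+ m.+1 * b * (1 - u * F^`().[a0] - u * (c * b' * w1)) +
      (c ^+ m.+1 * u * b) ^+ 2 * w2); first ring.
  by rewrite ue !exprS; ring.
have [|l lP] := cplA s.
  move=> m; have [[b Fb] _] := sP m; exists (- c * u * b).
  by rewrite [s m.+1]/= Fb exprS; ring.
exists l.
  apply: sepA => m; have [r ->] := lP m.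
  have [w ->] := hornerD_dvd F (s m) (c ^+ m * r).
  by have [[b ->] _] := sP m; exists (c * b + r * w); rewrite exprS; ring.
have [r ->] := lP 1%N; have [_ [b ->]] := sP 1%N.
by exists (b + r); rewrite expr1; ring.
Qed.
End Hensel.

(** * Hensel's lemma in the quotient A[X]/(g) *)

Section HenselModulus.
Variables (A : comNzRingType) (c : A) (g : {poly A}).
Hypotheses (sepA : cadic_separated c) (cplA : cadic_complete c).

Lemma in_qpoly_id (q : {poly %/ g}) : in_qpoly g q = q.
Proof. exact/val_inj/in_qpoly_small/size_mk_monic. Qed.

Lemma coef_in_qpolyC_mul (b : A) (q : {poly %/ g}) i :
  (in_qpoly g b%:P * q : {poly %/ g})`_i = b * q`_i.
Proof.
by rewrite -{1}[q]in_qpoly_id -in_qpolyM mul_polyC in_qpolyZ in_qpoly_id coefZ.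
Qed.

(** Residues modulo a monic polynomial are coefficient vectors, on which the constant [c] acts entry
    by entry. *)
Lemma qpoly_cadic_separated : cadic_separated (in_qpoly g c%:P).
Proof.
move=> q qP; apply/val_inj/polyP => i; rewrite coef0; apply: sepA => m.
have [b ->] := qP m; exists b`_i.
by rewrite -rmorphXn -polyC_exp coef_in_qpolyC_mul.
Qed.

Lemma qpoly_cadic_complete : cadic_complete (in_qpoly g c%:P).
Proof.
move=> s sP; set d := (size (mk_monic g)).-1.
have /fin_all_exists[l lP] (i : 'I_d) :
    exists l, forall m, exists r, l = (s m)`_i + c ^+ m * r.
  apply: cplA => m; have [r ->] := sP m; exists r`_i.
  by rewrite [LHS]coefD -rmorphXn -polyC_exp coef_in_qpolyC_mul.
(* The coefficient limits [l] are indexed by ['I_d]; the default 0 of [oapp] is never read, as only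
   indices below [d] occur. *)
have sz : (size (\poly_(j < d) oapp l 0 (insub j))%R <= d)%N by exact: size_poly.
exists (NPoly sz) => m.
have /fin_all_exists[r rP] := fun i => lP i m.
have szr : (size (\poly_(j < d) oapp r 0 (insub j))%R <= d)%N by exact: size_poly.
exists (NPoly szr); apply/val_inj/polyP => i.
rewrite [RHS]coefD -rmorphXn -polyC_exp coef_in_qpolyC_mul /= !coef_poly.
case: ltnP => [lt_id|le_di]; last first.
  by rewrite mulr0 addr0 nth_default // (leq_trans _ le_di) // size_npoly.
by rewrite (insubT (fun j => j < d)%N lt_id); exact: rP (Ordinal lt_id).
Qed.

Hypotheses (g_monic : g \is monic) (g_gt1 : (1 < size g)%N).

Lemma in_qpoly_dvd (p : {poly A}) : in_qpoly g p = 0 <-> exists q, p = q * g.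
Proof.
(* [mk_monic] replaces a modulus that is not monic of positive degree by a default; here it returns
   [g] itself. *)
have gE : mk_monic g = g by rewrite /mk_monic g_gt1 g_monic.
split=> [/(congr1 val)/= | [q ->]].
  rewrite gE => p0; exists (Pdiv.Ring.rdivp p g).
  by rewrite {1}[p](Pdiv.RingMonic.rdivp_eq g_monic) p0 addr0.
by apply/val_inj; rewrite /= gE Pdiv.RingMonic.rmodp_mull.
Qed.

Lemma horner_in_qpoly (F P : {poly A}) :
  (map_poly (in_qpoly g \o polyC) F).[in_qpoly g P] = in_qpoly g (F \Po P).
Proof. by rewrite map_poly_comp horner_map. Qed.

(** A root of F in A[X]/(g) is a polynomial P with F(P) divisible by g. This form lets roots be
    lifted to an unramified extension without putting an absolute value on that extension. *)
Lemma hensel_comp_poly (F P0 U : {poly A}) :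
  (exists q b, F \Po P0 = q * g + c%:P * b) ->
  (exists q b, U * (F^`() \Po P0) = 1 + q * g + c%:P * b) ->
  exists P, (exists q, F \Po P = q * g) /\
            (exists q b, P = P0 + q * g + c%:P * b).
Proof.
have gE q : in_qpoly g (q * g) = 0 by apply/in_qpoly_dvd; exists q.
move=> [q0 [b0 FP0]] [q1 [b1 UP0]].
have [||a] := @hensel _ _ (map_poly (in_qpoly g \o polyC) F)
    (in_qpoly g P0) (in_qpoly g U) qpoly_cadic_separated qpoly_cadic_complete.
- exists (in_qpoly g b0).
  by rewrite horner_in_qpoly FP0 in_qpolyD gE add0r in_qpolyM.
- exists (in_qpoly g b1).
  rewrite deriv_map horner_in_qpoly -in_qpolyM UP0.
  by rewrite !in_qpolyD gE addr0 in_qpoly1 in_qpolyM.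
move=> Fa [b aE]; exists a; split.
  by apply/in_qpoly_dvd; rewrite -horner_in_qpoly in_qpoly_id.
have /in_qpoly_dvd[q qE] : in_qpoly g ((a : {poly A}) - P0 - c%:P * (b : {poly A})) = 0.
  by rewrite !raddfB /= in_qpolyM !in_qpoly_id aE; ring.
by exists q, (b : {poly A}); rewrite -qE; ring.
Qed.

End HenselModulus.

(** * Reduction of polynomials over a valuation ring *)

Section ValuationRing.
Variables (O : comNzRingType) (K : fieldType) (k : finFieldType).
Variables (iota : {rmorphism O -> K}) (red : {rmorphism O -> k}).
Hypothesis red_surj : forall y, exists a, red a = y.
Hypothesis iota_inj : injective iota.
Hypothesis iota_total : forall x : K,
  (exists a, iota a = x) \/ (exists2 a, iota a = x^-1 & red a = 0).

Lemma iota_eq0 a : (iota a == 0) = (a == 0).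
Proof. by rewrite -(inj_eq iota_inj) rmorph0. Qed.

Lemma dvd_total (a b : O) : (exists r, b = a * r) \/ (exists r, a = b * r).
Proof.
have [->|a0] := eqVneq a 0; first by right; exists 0; rewrite mulr0.
have [->|b0] := eqVneq b 0; first by left; exists 0; rewrite mulr0.
rewrite -!iota_eq0 in a0 b0.
have [[r rE]|[r rE _]] := iota_total (iota b / iota a).
  by left; exists r; apply: iota_inj; rewrite rmorphM rE mulrC divfK.
right; exists r; apply: iota_inj; rewrite rmorphM rE invf_div mulrC.
by rewrite divfK.
Qed.

(** No uniformizer is at hand, but divisibility is total, so one of finitely many coefficients in
    the kernel of [red] divides all others. This [c] serves as the modulus for Hensel's lemma. *)
Lemma red0_common_divisor (p : {poly O}) : map_poly red p = 0 ->
  exists2 c, red c = 0 & exists r, p = c%:P * r.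
Proof.
elim/poly_ind: p => [_|p a IHp].
  by exists 0; [exact: rmorph0 | exists 0; rewrite mulr0].
rewrite rmorphD rmorphM /= map_polyX map_polyC /= => pa0.
have ra : red a = 0.
  by have /polyP/(_ 0%N) := pa0; rewrite coefD coefMX coefC /= add0r coef0.
have rp : map_poly red p = 0.
  apply/polyP => i; have /polyP/(_ i.+1) := pa0.
  by rewrite coefD coefMX coefC /= addr0 coef0 => ->; rewrite coef0.
have [c rc [r pr]] := IHp rp.
have [[s ->]|[s cs]] := dvd_total c a.
  exists c => //; exists (r * 'X + s%:P).
  by rewrite pr polyCM; ring.
exists a => //; exists (s%:P * r * 'X + 1).
by rewrite pr cs polyCM; ring.
Qed.

Lemma red0_common_divisor2 (p1 p2 : {poly O}) :
  map_poly red p1 = 0 -> map_poly red p2 = 0 ->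
  exists2 c, red c = 0 & (exists r, p1 = c%:P * r) /\ (exists r, p2 = c%:P * r).
Proof.
move=> /red0_common_divisor[c1 rc1 [r1 ->]] /red0_common_divisor[c2 rc2 [r2 ->]].
have [[s ->]|[s ->]] := dvd_total c1 c2.
  by exists c1 => //; split; [exists r1 | exists (s%:P * r2); rewrite polyCM mulrA].
by exists c2 => //; split; [exists (s%:P * r1); rewrite polyCM mulrA | exists r2].
Qed.

Lemma red_poly_surj (p : {poly k}) : exists P : {poly O}, map_poly red P = p.
Proof.
elim/poly_ind: p => [|p a [P <-]]; first by exists 0; rewrite rmorph0.
have [b rb] := red_surj a; exists (P * 'X + b%:P).
by rewrite rmorphD rmorphM /= map_polyX map_polyC /= rb.
Qed.

Lemma red_monic_surj (p : {poly k}) : p \is monic ->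
  exists P : {poly O}, [/\ map_poly red P = p, P \is monic & size P = size p].
Proof.
(* Only the part below the leading term is lifted, and then truncated, since the lift [Q] may have
   terms of higher degree that reduce to 0. *)
move=> p_monic; have [Q QE] := red_poly_surj (p - 'X^((size p).-1)).
have sp : (0 < size p)%N by rewrite lt0n size_poly_eq0 monic_neq0.
pose P := 'X^((size p).-1) + \poly_(i < (size p).-1) Q`_i.
have sP : size P = size p.
  by rewrite /P size_polyDl; rewrite size_polyXn ?ltnS ?size_poly ?prednK.
exists P; split => //; last first.
  rewrite monicE /lead_coef sP coefD coefXn eqxx coef_poly ltnn addr0 //.
apply/polyP => i; rewrite coef_map coefD coefXn coef_poly /=.
have /polyP/(_ i) := QE; rewrite coef_map coefB coefXn => QEi.
have [->|ip] := eqVneq i (size p).-1.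
  by rewrite ltnn addr0 -lead_coefE (monicP p_monic); exact: rmorph1.
rewrite (negPf ip) subr0 in QEi; rewrite add0r; case: ltnP => [_|pi]; first exact: QEi.
rewrite [RHS]nth_default; first exact: rmorph0.
by rewrite -(prednK sp) ltn_neqAle eq_sym ip.
Qed.

Lemma primitive_multiple (p : {poly K}) : p != 0 ->
  exists (c : K) (P : {poly O}),
    [/\ c != 0, map_poly iota P = c *: p & map_poly red P != 0].
Proof.
(* Dividing by a coefficient of largest absolute value makes that coefficient equal to 1; this
   stronger form is what the induction carries. *)
move=> p0; suff [c [P [c0 PE [i Pi]]]] : exists (c : K) (P : {poly O}),
   [/\ c != 0, map_poly iota P = c *: p & exists i, P`_i = 1].
  exists c, P; split => //; apply: contra_eq_neq Pi => /polyP/(_ i).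
  rewrite coef_map coef0 /= => Pi; apply: contra_eq_neq Pi => ->.
  by rewrite rmorph1 oner_eq0.
elim/poly_ind: p p0 => [|p a IHp]; first by rewrite eqxx.
have [->|p0 _] := eqVneq p 0.
  rewrite mul0r add0r polyC_eq0 => a0; exists a^-1, 1; split.
  - by rewrite invr_eq0.
  - by rewrite rmorph1 -mul_polyC -polyCM mulVf.
  - by exists 0%N; rewrite coef1.
have [c [P [c0 PE [i Pi]]]] := IHp p0.
have [[b bE]|[b bE rb]] := iota_total (c * a).
  exists c, (P * 'X + b%:P); split => //; last first.
    by exists i.+1; rewrite coefD coefMX coefC addr0.
  rewrite rmorphD rmorphM /= map_polyX PE map_polyC /= bE.
  by rewrite scalerDr scalerAl -!mul_polyC polyCM.
(* Since the inverse of 0 is 0, the second alternative of [iota_total] also occurs for [a = 0],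
   which is treated apart. *)
have b0 : iota b != 0 \/ a = 0.
  have [->|a0] := eqVneq a 0; first by right.
  by left; rewrite bE invr_eq0 mulf_neq0.
case: b0 => [b0|a0]; last first.
  exists c, (P * 'X); split => //; last by exists i.+1; rewrite coefMX.
  by rewrite rmorphM /= map_polyX PE a0 addr0 scalerAl.
exists (c * iota b), (b *: P * 'X + 1); split; first exact: mulf_neq0.
  rewrite rmorphD rmorphM rmorph1 /= map_polyZ map_polyX /= PE scalerA.
  rewrite scalerDr scalerAl [iota b * c]mulrC; congr (_ + _).
  have ca0 : c * a != 0 by move: b0; rewrite bE invr_eq0.
  by rewrite -mul_polyC -polyCM bE mulrAC divff.
by exists 0%N; rewrite coefD coefMX coef1 add0r.
Qed.

(* Gauss's lemma: a factorization over K rescales to one of an associate of g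
   over O, and this reduces to a factorization of the same degrees. *)
Lemma irreducible_lift (g : {poly O}) : g \is monic ->
  irreducible_poly (map_poly red g) -> irreducible_poly (map_poly iota g).
Proof.
move=> g_monic [sg irr_g].
have sge (A : nzRingType) (h : {rmorphism O -> A}) : size (map_poly h g) = size g.
  by rewrite size_map_poly_id0 // (monicP g_monic) rmorph1 oner_eq0.
split=> [|p sp]; first by rewrite sge -(sge _ red).
case/dvdpP=> r gE.
have g0 : map_poly iota g != 0.
  by rewrite monic_neq0 // (monic_map iota g_monic).
have [r0 p0] : r != 0 /\ p != 0.
  by split; apply: contraNneq g0 => z; rewrite gE z ?mulr0 ?mul0r.
have [c [P [c0 PE rP]]] := primitive_multiple p0.
have [e [R [e0 RE rR]]] := primitive_multiple r0.
have RP : map_poly iota (R * P) = (e * c) *: map_poly iota g.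
  by rewrite rmorphM /= PE RE gE -scalerAl -scalerAr scalerA.
have [w wE] : exists w, iota w = e * c.
  exists (R * P)`_(size g).-1; rewrite -coef_map RP coefZ coef_map /=.
  by have := monicP g_monic; rewrite /lead_coef => ->; rewrite rmorph1 mulr1.
have RPE : R * P = w *: g.
  by apply: (map_inj_poly iota_inj (rmorph0 iota)); rewrite RP map_polyZ /= wE.
have sP : size P = size p.
  by rewrite -(size_map_inj_poly iota_inj (rmorph0 iota)) PE size_scale.
have sR : size R = size r.
  by rewrite -(size_map_inj_poly iota_inj (rmorph0 iota)) RE size_scale.
have redRP : map_poly red R * map_poly red P = red w *: map_poly red g.
  by rewrite -rmorphM RPE /= map_polyZ.
have w0 : red w != 0.
  apply: contraNneq (mulf_neq0 rR rP) => w0; by rewrite redRP w0 scale0r.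
have szRP : (size r + size p)%N = (size g).+1.
  have := size_mul r0 p0; rewrite -gE sge => ->; rewrite prednK //.
  by rewrite addn_gt0 size_poly_gt0 r0.
have szbar : (size (map_poly red R) + size (map_poly red P))%N = (size g).+1.
  have := size_mul rR rP; rewrite redRP size_scale // sge => ->; rewrite prednK //.
  by rewrite addn_gt0 size_poly_gt0 rR.
(* Reduction can only lower the two sizes, while their sum is unchanged, so neither drops. *)
have sPE : size (map_poly red P) = size p.
  have h1 : (size (map_poly red P) <= size P)%N by exact: size_poly.
  have h2 : (size (map_poly red R) <= size R)%N by exact: size_poly.
  apply/eqP; rewrite eqn_leq -{1}sP h1 /= -(leq_add2l (size r)) szRP -szbar.
  by rewrite leq_add2r -sR.
have := irr_g (map_poly red P); rewrite sPE => /(_ sp).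
have -> : map_poly red P %| map_poly red g.
  by rewrite -(dvdpZr _ _ w0) -redRP dvdp_mulIr.
move=> /(_ isT)/eqp_size; rewrite sPE sge => spg.
by rewrite -dvdp_size_eqp gE ?dvdp_mulIr // -gE sge spg.
Qed.

End ValuationRing.

(** * Frobenius on finite extensions of a finite field *)

Section FiniteFrobenius.
Variables (k : finFieldType) (kk : fieldExtType k).
Local Notation q := #|k|.

Lemma frobD (e : nat) (x y : kk) :
  (x + y) ^+ (q ^ e) = x ^+ (q ^ e) + y ^+ (q ^ e).
Proof.
have [p p_pr pchar_k] := finPcharP k.
have pchar_kk : p \in [pchar kk] by rewrite (fmorph_pchar (in_alg kk)).
apply: exprDn_pchar; have := card_pprimeChar pchar_k.
rewrite -[#|pPrimeCharType _|]/q => ->; rewrite -expnM pnatX orbC.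
by rewrite (eq_pnat _ (pcharf_eq pchar_kk)) pnat_id ?orbT.
Qed.

Lemma frob0 (e : nat) : (0 : kk) ^+ (q ^ e) = 0.
Proof. by rewrite expr0n expn_eq0 (gtn_eqF (ltnW (finNzRing_gt1 k))). Qed.

Lemma frob_inj (e : nat) : injective (fun x : kk => x ^+ (q ^ e)).
Proof.
move=> x y /= xy; apply/eqP; rewrite -subr_eq0.
suff : (x - y) ^+ (q ^ e) == 0 by rewrite expf_eq0 => /andP[].
by rewrite -(inj_eq (addrI (y ^+ (q ^ e)))) -frobD addrC subrK xy addr0.
Qed.

Lemma frob_alg (e : nat) (a : k) : (a%:A : kk) ^+ (q ^ e) = a%:A.
Proof.
elim: e => [|e IHe]; first by rewrite expn0 expr1.
by rewrite expnSr exprM IHe -in_algE -rmorphXn /= expf_card.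
Qed.

Definition frob (e : nat) (x : kk) : kk := x ^+ (q ^ e).

Fact frob_is_zmod_morphism e : zmod_morphism (frob e).
Proof.
by move=> x y; apply: (addIr (frob e y)); rewrite /frob -frobD !subrK.
Qed.

Fact frob_is_monoid_morphism e : monoid_morphism (frob e).
Proof. by split=> [|x y]; rewrite /frob ?expr1n ?exprMn. Qed.

HB.instance Definition _ e :=
  GRing.isZmodMorphism.Build kk kk (frob e) (frob_is_zmod_morphism e).
HB.instance Definition _ e :=
  GRing.isMonoidMorphism.Build kk kk (frob e) (frob_is_monoid_morphism e).

Lemma frob_horner (e : nat) (p : {poly kk}) y :
  (forall i, p`_i ^+ (q ^ e) = p`_i) -> p.[y] ^+ (q ^ e) = p.[y ^+ (q ^ e)].
Proof.
elim/poly_ind: p => [|p c IHp] pc; first by rewrite !horner0 frob0.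
rewrite !hornerE frobD exprMn IHp => [|i].
  by have := pc 0%N; rewrite coefD coefMX coefC /= add0r => ->.
by have := pc i.+1; rewrite coefD coefMX coefC /= addr0.
Qed.

Lemma frob_horner_alg (e : nat) (p : {poly k}) (y : kk) :
  (map_poly (in_alg kk) p).[y] ^+ (q ^ e) =
  (map_poly (in_alg kk) p).[y ^+ (q ^ e)].
Proof. by apply: frob_horner => i; rewrite coef_map /= frob_alg. Qed.

(** The fixed points of a power of Frobenius form a field containing [k]; the induction adjoins the
    generators one at a time. *)
Lemma frob_fixed_adjoin (e : nat) (xs : seq kk) y :
  {in xs, forall x, x ^+ (q ^ e) = x} -> y \in <<1 & xs>>%VS ->
  y ^+ (q ^ e) = y.
Proof.
elim/last_ind: xs y => [|xs x IHxs] y xsP.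
  by rewrite Fadjoin_nil => /vlineP[a ->]; rewrite frob_alg.
rewrite adjoin_rcons => /Fadjoin_polyP[p pU ->].
have xE : x ^+ (q ^ e) = x by apply: xsP; rewrite mem_rcons mem_head.
rewrite frob_horner ?xE // => i; apply: IHxs; last exact/polyOverP.
by move=> z zxs; apply: xsP; rewrite mem_rcons in_cons zxs orbT.
Qed.

(* If th^(q^e) = th, then the q^d elements of k(th) are roots of X^(q^e) - X. *)
Lemma frob_orbit_inj (th : kk) i j :
  (i < (size (minPoly 1 th)).-1)%N -> (j < (size (minPoly 1 th)).-1)%N ->
  th ^+ (q ^ i) = th ^+ (q ^ j) -> i = j.
Proof.
set d := (size _).-1; wlog lt_ij : i j / (i < j)%N => [hw id jd ij|].
  have [lt_ij|lt_ji|//] := ltngtP i j; first exact: hw.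
  by apply/esym/hw.
move=> id jd; rewrite -(subnKC (ltnW lt_ij)); set e := (j - i)%N.
rewrite expnD mulnC exprM => /frob_inj/esym the.
have q_gt1 := finNzRing_gt1 k.
have e_gt0 : (0 < e)%N by rewrite subn_gt0.
have size_qe : size ('X^(q ^ e) - 'X : {poly kk}) = (q ^ e).+1.
  rewrite size_polyDl size_polyXn // size_polyN size_polyX ltnS.
  by rewrite -[X in (X < _)%N](exp1n e) ltn_exp2r.
pose F (p : {poly_d k}) := (map_poly (in_alg kk) p).[th].
have F_inj : injective F.
  move=> p p' pp'; apply/val_inj/eqP; rewrite -subr_eq0 /=.
  rewrite -(map_poly_eq0 (in_alg kk)); apply: contraTT isT => nz.
  have : minPoly 1 th %| map_poly (in_alg kk) (val p - val p').
    apply: minPoly_dvdp; first by apply/polyOver1P; exists (val p - val p').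
    by rewrite rootE rmorphB hornerD hornerN -/(F p) -/(F p') pp' subrr.
  move/(dvdp_leq nz); rewrite leqNgt => /negP[].
  rewrite size_map_poly (leq_ltn_trans (size_polyD _ _)) // size_polyN.
  rewrite gtn_max.
  have szd (r : {poly_d k}) : (size r < size (minPoly 1 th))%N.
    by rewrite (leq_ltn_trans (size_npoly r)) // /d size_minPoly.
  by rewrite !szd.
have nz : 'X^(q ^ e) - 'X != 0 :> {poly kk} by rewrite -size_poly_eq0 size_qe.
suff : (q ^ d <= q ^ e)%N.
  by rewrite leq_exp2l // leqNgt (leq_ltn_trans (leq_subr _ _)).
rewrite -card_npoly cardE -(size_map F) -ltnS -size_qe.
apply: max_poly_roots => //; last by rewrite map_inj_uniq ?enum_uniq.
apply/allP => _ /mapP[p _ ->]; rewrite rootE !hornerE subr_eq0.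
by rewrite frob_horner_alg the.
Qed.

(** The minimal polynomial divides X^(q^d) - X, whose derivative is the constant -1, so [th] cannot
    be a double root. *)
Lemma deriv_minPoly_neq0 (th : kk) : (minPoly 1 th)^`().[th] != 0.
Proof.
set E := <<1; th>>%AS; set d := \dim E.
have d_gt0 : (0 < d)%N by exact: adim_gt0.
have thd : th ^+ (q ^ d) = th.
  have := Fermat's_little_theorem E th; rewrite memv_adjoin => /esym/eqP.
  exact.
have : minPoly 1 th %| 'X^(q ^ d) - 'X.
  apply: minPoly_dvdp; first by rewrite rpredB ?rpredX ?polyOverX.
  by rewrite rootE !hornerE thd subrr.
have := minPolyxx 1 th; move: (minPoly 1 th) => m m0.
have qd0 : q%:R = 0 :> kk.
  rewrite -(rmorph_nat (in_alg kk)).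
  have [p p_pr pchar_k] := finPcharP k.
  have := card_pprimeChar pchar_k; rewrite -[#|pPrimeCharType _|]/q.
  case: (logn _ _) => [k1|e ->].
    by have := finNzRing_gt1 k; rewrite k1.
  by rewrite natrX exprS (pcharf0 pchar_k) mul0r rmorph0.
case/dvdpP=> r /(congr1 deriv)/(congr1 (horner^~ th)).
rewrite derivB derivXn derivX derivM !hornerE m0 mulr0 add0r.
rewrite hornerMn -mulr_natr natrX qd0 expr0n gtn_eqF // mulr0 sub0r => rm.
by apply: contra_eq_neq rm => ->; rewrite mulr0 oppr_eq0 oner_eq0.
Qed.

End FiniteFrobenius.

(** * Galois groups of polynomials with separable reduction *)

Section EvalPoly.
Variables (A B : comNzRingType) (phi : {rmorphism A -> B}) (z : B).

(** Two instances are compared below: evaluation at [th] over the residue field, and at a root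
    [theta] of the lift [g]. A polynomial over [O] thus stands both for an element of O[theta] and
    for its residue. *)
Definition eval_poly : {poly A} -> B := horner_eval z \o map_poly phi.
HB.instance Definition _ := GRing.RMorphism.on eval_poly.

Lemma eval_polyE P : eval_poly P = (map_poly phi P).[z].
Proof. by []. Qed.

Lemma eval_polyC a : eval_poly a%:P = phi a.
Proof. by rewrite eval_polyE map_polyC hornerC. Qed.

Lemma eval_poly_comp F P : eval_poly (F \Po P) = (map_poly phi F).[eval_poly P].
Proof. by rewrite !eval_polyE map_comp_poly horner_comp. Qed.

End EvalPoly.

Section LocalGalois.
Variables (O : comNzRingType) (K : fieldType) (k : finFieldType).
Variables (iota : {rmorphism O -> K}) (red : {rmorphism O -> k}).
Hypothesis red_surj : forall y, exists a, red a = y.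
Hypothesis iota_inj : injective iota.
Hypothesis iota_total : forall x : K,
  (exists a, iota a = x) \/ (exists2 a, iota a = x^-1 & red a = 0).
Hypothesis cadic : forall c, red c = 0 -> cadic_separated c /\ cadic_complete c.

Variables (kk : fieldExtType k) (th : kk) (g : {poly O}).
Local Notation q := #|k|.
Local Notation redk := (in_alg kk \o red).
Hypothesis g_monic : g \is monic.
Hypothesis gE : map_poly redk g = minPoly 1 th.

Local Notation res := (eval_poly redk th).
Local Notation d := (size g).-1.

Lemma map_redk P : map_poly redk P = map_poly (in_alg kk) (map_poly red P).
Proof. exact: map_poly_comp. Qed.

Lemma size_minPoly_lift : size (minPoly 1 th) = size g.
Proof.
by rewrite -gE size_map_poly_id0 // (monicP g_monic) rmorph1 oner_eq0.
Qed.

Lemma size_lift_gt1 : (1 < size g)%N.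
Proof. by rewrite -size_minPoly_lift size_minPoly ltnS. Qed.

Lemma res_lift : res g = 0.
Proof. by rewrite eval_polyE gE minPolyxx. Qed.

(** The kernel of O[X] -> k(th) is generated by [g] and the polynomials with zero reduction, because
    [g] lifts the minimal polynomial of [th]. *)
Lemma res_eq0 P : res P = 0 -> exists Q, map_poly red (P - Q * g) = 0.
Proof.
rewrite eval_polyE => P0.
have : minPoly 1 th %| map_poly redk P.
  apply: minPoly_dvdp; last exact/rootP.
  by rewrite map_redk; apply/polyOver1P; exists (map_poly red P).
rewrite -gE !map_redk dvdp_map => /dvdpP[r rE].
have [Q QE] := red_poly_surj red_surj r; exists Q.
by rewrite rmorphB rmorphM /= QE rE subrr.
Qed.

Lemma res_surj y : y \in <<1; th>>%VS -> exists P, res P = y.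
Proof.
case/Fadjoin1_polyP=> p ->; have [P <-] := red_poly_surj red_surj p.
by exists P; rewrite eval_polyE map_redk.
Qed.

Lemma res_in_adjoin P : res P \in <<1; th>>%VS.
Proof.
apply/Fadjoin1_polyP; exists (map_poly red P).
by rewrite eval_polyE map_redk.
Qed.

(** Simple roots in k(th) lift to O[X]/(g): [P0] lifts the root, [U] the inverse of the derivative
    there. *)
Lemma hensel_res (F : {poly O}) y : y \in <<1; th>>%VS ->
  root (map_poly redk F) y -> (map_poly redk F)^`().[y] != 0 ->
  exists P, (exists Q, F \Po P = Q * g) /\ res P = y.
Proof.
move=> /res_surj[P0 P0y] /rootP Fy F'y.
have [Q1 Q1E] : exists Q, map_poly red (F \Po P0 - Q * g) = 0.
  by apply: res_eq0; rewrite eval_poly_comp P0y.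
have resF' : res (F^`() \Po P0) = (map_poly redk F)^`().[y].
  by rewrite eval_poly_comp P0y deriv_map.
have [U UE] : exists U, res U = (res (F^`() \Po P0))^-1.
  by apply: res_surj; rewrite rpredV res_in_adjoin.
have [Q2 Q2E] : exists Q, map_poly red (U * (F^`() \Po P0) - 1 - Q * g) = 0.
  apply: res_eq0; rewrite rmorphB rmorphM rmorph1 /= UE mulVf ?subrr //.
  by rewrite resF'.
(* Both congruences must hold modulo powers of one element, so a common divisor [c] of the two error
   terms is taken. *)
have [c rc [[r1 r1E] [r2 r2E]]] := red0_common_divisor2 iota_inj iota_total Q1E Q2E.
have [sepc cplc] := cadic rc.
have [||P [[Q PQ] [s [b PE]]]] :=
    @hensel_comp_poly _ c g sepc cplc g_monic size_lift_gt1 F P0 U.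
- by exists Q1, r1; rewrite -r1E; ring.
- by exists Q2, r2; rewrite -r2E; ring.
exists P; split; first by exists Q.
rewrite PE !rmorphD !rmorphM /= P0y res_lift mulr0 addr0.
by rewrite eval_polyC /= rc scale0r mul0r addr0.
Qed.

Lemma irreducible_minPoly1 (p : {poly k}) :
  map_poly (in_alg kk) p = minPoly 1 th -> irreducible_poly p.
Proof.
move=> pE; split=> [|r sr rp].
  by rewrite -(size_map_poly (in_alg kk)) pE size_minPoly ltnS.
have := minPoly_irr (p := map_poly (in_alg kk) r) (K := 1%AS) (x := th).
rewrite -pE dvdp_map eqp_map => minr.
have /minr : map_poly (in_alg kk) r \is a polyOver 1%AS.
  by apply/polyOver1P; exists r.
move=> /(_ rp)/orP[//|].
by rewrite -size_poly_eq1 size_map_poly (negPf sr).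
Qed.

Lemma irreducible_iota_lift : irreducible_poly (map_poly iota g).
Proof.
apply: irreducible_lift g_monic _ => //; apply: irreducible_minPoly1.
by rewrite -gE map_redk.
Qed.

(** The conjugate th^(q^i) is a simple root of the reduction of [g]. Its lift expresses a conjugate
    of theta as a polynomial in theta. *)
Lemma frob_lift_exists (i : nat) :
  exists P, (exists Q, g \Po P = Q * g) /\ res P = th ^+ (q ^ i).
Proof.
apply: hensel_res; first by rewrite rpredX ?memv_adjoin.
  by rewrite gE -gE map_redk rootE -frob_horner_alg -map_redk gE
    minPolyxx frob0.
rewrite map_redk deriv_map -frob_horner_alg -deriv_map -map_redk gE.
by rewrite expf_eq0 negb_and deriv_minPoly_neq0 orbT.
Qed.

Section Extension.
Variables (E : fieldType) (jE : {rmorphism K -> E}) (theta : E).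
Local Notation ev := (eval_poly (jE \o iota) theta).
Hypothesis root_theta : ev g = 0.

(* Makes the residue of an element R(theta), R over O, well defined. *)
Lemma ev0_res P : ev P = 0 -> res P = 0.
Proof.
move=> P0.
have irr := irreducible_iota_lift.
have : map_poly iota g %| map_poly iota P.
  have [cop|] := boolP (coprimep (map_poly iota g) (map_poly iota P)).
    move: cop; rewrite -(coprimep_map jE) -!map_poly_comp.
    move/coprimep_root => /(_ theta); rewrite rootE -!eval_polyE root_theta P0 eqxx.
    by move/(_ isT)/eqP.
  rewrite /coprimep => sg; have := irr.2 _ sg (dvdp_gcdl _ _).
  by move/eqp_dvdl <-; rewrite dvdp_gcdr.
rewrite {1}(Pdiv.RingMonic.rdivp_eq g_monic P).
set Q := Pdiv.Ring.rdivp _ _; set R := Pdiv.Ring.rmodp _ _.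
rewrite rmorphD rmorphM /= dvdp_addr ?dvdp_mulIr // => gR.
have R0 : R = 0.
  apply/eqP; apply: contraTT gR => R0; apply/negP.
  have R0' : map_poly iota R != 0.
    by rewrite map_poly_eq0_id0 // iota_eq0 // lead_coef_eq0.
  move/(dvdp_leq R0'); rewrite !size_map_inj_poly ?rmorph0 // leqNgt.
  by rewrite Pdiv.Ring.ltn_rmodpN0 // monic_neq0.
by rewrite (Pdiv.RingMonic.rdivp_eq g_monic P) -/R R0 addr0 rmorphM /= res_lift mulr0.
Qed.

Lemma ev_inj_res P P' : ev P = ev P' -> res P = res P'.
Proof.
move/eqP; rewrite -subr_eq0 -rmorphB => /eqP/ev0_res/eqP.
by rewrite rmorphB subr_eq0 => /eqP.
Qed.

(** The values of the lifts at theta are roots of [f], distinct because their residues are, and as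
    numerous as the degree. *)
Lemma ev_split (m : nat) (f : {poly O}) (y : 'I_m -> kk) (P : 'I_m -> {poly O}) :
  f \is monic -> size f = m.+1 -> injective y ->
  (forall i, (exists Q, f \Po P i = Q * g) /\ res (P i) = y i) ->
  map_poly (jE \o iota) f = \prod_i ('X - (ev (P i))%:P).
Proof.
move=> f_monic sf y_inj PP.
have fm : map_poly (jE \o iota) f \is monic by rewrite monic_map.
rewrite -(big_map (fun i => ev (P i)) xpredT (fun z => 'X - z%:P)).
rewrite [LHS](@all_roots_prod_XsubC _ _ [seq ev (P i) | i <- index_enum 'I_m]).
- by rewrite (monicP fm) scale1r.
- rewrite size_map_poly_id0; last by rewrite (monicP f_monic) rmorph1 oner_eq0.
  by rewrite sf size_map /index_enum -enumT size_enum_ord.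
- apply/allP => _ /mapP[i _ ->]; have [[Q fP] _] := PP i.
  by rewrite rootE -eval_poly_comp fP rmorphM /= root_theta mulr0.
- rewrite uniq_rootsE map_inj_uniq ?index_enum_uniq // => i j /ev_inj_res.
  by rewrite !(PP _).2 => /y_inj.
Qed.

End Extension.

Section Factorization.
Variables (n : nat) (x : 'I_n -> kk) (sigma : 'S_n) (f : {poly O}).
Hypotheses (f_monic : f \is monic) (size_f : size f = n.+1).
Hypothesis x_inj : injective x.
Hypothesis fE : map_poly redk f = \prod_i ('X - (x i)%:P).
Hypothesis x_frob : forall i, x i ^+ q = x (sigma i).
Hypothesis x_th : forall i, x i \in <<1; th>>%VS.
Hypothesis th_x : th \in <<1 & codom x>>%VS.

Lemma frob_perm i j : x j ^+ (q ^ i) = x ((sigma ^+ i)%g j).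
Proof.
elim: i => [|i IHi]; first by rewrite expg0 perm1 expn0 expr1.
by rewrite expgSr permM expnSr exprM IHi x_frob.
Qed.

Lemma lifted_root_exists i :
  exists P, (exists Q, f \Po P = Q * g) /\ res P = x i.
Proof.
have fi : map_poly redk f = ('X - (x i)%:P) * \prod_(j | j != i) ('X - (x j)%:P).
  by rewrite fE (bigD1 i).
apply: hensel_res => //; first by rewrite fi rootM root_XsubC eqxx.
rewrite fi derivM derivXsubC mul1r !hornerE subrr mul0r addr0.
rewrite horner_prod; apply/prodf_neq0 => j ji.
by rewrite !hornerE subr_eq0 (inj_eq x_inj) eq_sym.
Qed.

Variable P : 'I_n -> {poly O}.
Hypothesis PP : forall i, (exists Q, f \Po P i = Q * g) /\ res (P i) = x i.

(** Substituting a lift of th^(q^i) acts on residues as the i-th power of Frobenius, since reduced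
    coefficients lie in [k], which Frobenius fixes. *)
Lemma res_comp_frob (R T : {poly O}) i : res T = th ^+ (q ^ i) ->
  res (R \Po T) = res R ^+ (q ^ i).
Proof.
by move=> rT; rewrite eval_poly_comp rT eval_polyE map_redk -frob_horner_alg.
Qed.

(** All conjugates of theta lie in K(theta): there are [d] distinct powers th^(q^i) with i < d, and
    each has a lift. *)
Lemma root_lift_split (E : fieldType) (jE : {rmorphism K -> E}) (theta : E) :
  eval_poly (jE \o iota) theta g = 0 ->
  exists T : 'I_d -> {poly O}, (forall i, res (T i) = th ^+ (q ^ i)) /\
    map_poly (jE \o iota) g =
      \prod_i ('X - (eval_poly (jE \o iota) theta (T i))%:P).
Proof.
move=> g0; have /fin_all_exists[T TP] := fun i : 'I_d => frob_lift_exists i.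
exists T; split=> [i|]; first by case: (TP i).
have sg : size g = d.+1 by rewrite prednK // (leq_trans _ size_lift_gt1).
apply: (ev_split g0 g_monic sg _ TP) => i j ij; apply: val_inj.
by apply: frob_orbit_inj ij; rewrite size_minPoly_lift.
Qed.

(* The roots of minPoly U theta are among the lifts of the th^(q^i), and such a
   lift must fix every residue x_j, which forces i = 0 as th is in k(x). *)
Lemma lift_in_subfield (F0 : fieldType) (E : fieldExtType F0) (U : {subfield E})
    (jE : {rmorphism K -> E}) (theta : E) :
  eval_poly (jE \o iota) theta g = 0 -> (forall a, jE a \in U) ->
  (forall i, eval_poly (jE \o iota) theta (P i) \in U) -> theta \in U.
Proof.
move=> g0 jU PU; set ev := eval_poly _ _ in g0 PU.
have [T [resT gT]] := root_lift_split g0.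
have polyU (R : {poly O}) : map_poly (jE \o iota) R \is a polyOver U.
  by apply/polyOverP => i; rewrite coef_map /= jU.
have m_g : minPoly U theta %| map_poly (jE \o iota) g.
  by apply: minPoly_dvdp => //; apply/rootP.
rewrite gT in m_g; have [b mE] := dvdp_prod_XsubC m_g.
have m_root i : root (minPoly U theta) (ev (T i)) -> i = 0%N :> nat.
  (* The value of [P j] at theta lies in [U], so every conjugate of theta over [U] gives it too.
     Comparing residues at the conjugate [T i] shows that x_j^(q^i) = x_j. *)
  move=> mi; have x_fix : {in codom x, forall y, y ^+ (q ^ i) = y}.
    move=> _ /codomP[j ->].
    have mP : minPoly U theta %| map_poly (jE \o iota) (P j) - (ev (P j))%:P.
      apply: minPoly_dvdp; first by rewrite rpredB ?polyOverC.
      by rewrite rootE hornerD hornerN hornerC subrr.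
    have := dvdp_trans _ mP; move: mi; rewrite -dvdp_XsubCl => mi /(_ _ mi).
    rewrite dvdp_XsubCl rootE hornerD hornerN hornerC subr_eq0.
    rewrite -eval_poly_comp => /eqP/(ev_inj_res g0).
    by rewrite (res_comp_frob _ (resT i)) (PP j).2.
  have th_i := frob_fixed_adjoin x_fix th_x.
  apply: (@frob_orbit_inj _ _ th i 0%N); rewrite ?size_minPoly_lift //.
  by rewrite -subn1 subn_gt0 size_lift_gt1.
(* The only possible root has index 0, and the roots have distinct indices, so the minimal
   polynomial over [U] is linear. *)
suff : (size (minPoly U theta) <= 2)%N.
  by rewrite size_minPoly ltnS -adjoin_deg_eq1 eqn_leq => ->.
rewrite (eqp_size mE) size_prod_XsubC ltnS.
set s := mask _ _ in mE *; have s_uniq : uniq s by rewrite mask_uniq ?index_enum_uniq.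
have s0 i : i \in s -> i = 0%N :> nat.
  move=> si; apply: m_root; rewrite (eqp_root mE) -(big_map (fun i => ev (T i)) xpredT
    (fun z => 'X - z%:P)) root_prod_XsubC.
  exact: map_f.
case: s s_uniq s0 {mE} => [|i [|j s]] //= /andP[].
rewrite inE negb_or => /andP[ij _] _ s0; case/eqP: ij; apply: ord_inj.
by rewrite !s0 ?inE ?eqxx ?orbT.
Qed.

Lemma gal_eval_poly (L : splittingFieldType K) (gam : gal_of {:L}) theta R :
  gam (eval_poly (in_alg L \o iota) theta R) =
  eval_poly (in_alg L \o iota) (gam theta) R.
Proof.
rewrite !eval_polyE -horner_map /= -map_poly_comp; congr (_).[_].
by apply: eq_map_poly => a /=; rewrite linearZ rmorph1.
Qed.

(** An automorphism sends theta to some T_i(theta), hence P_j(theta) to P_j(T_i(theta)), whose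
    residue is x_j^(q^i). As residues separate the roots of [f], it acts on them as sigma^i.
    Conversely each T_i(theta) is a conjugate of theta. *)
Lemma gal_lifted_roots (L : splittingFieldType K) (theta : L) (s : 'S_n) :
  let ev := eval_poly (in_alg L \o iota) theta in ev g = 0 ->
  (exists2 gam, gam \in 'Gal({:L} / 1%AS)%g &
     forall i, gam (ev (P i)) = ev (P (s i))) <-> s \in <[sigma]>%g.
Proof.
move=> ev g0; have gam_ev := gal_eval_poly.
split=> [[gam _ gamP]|/cycleP[i ->]].
  have [T [resT gT]] := root_lift_split g0.
  have : root (map_poly (in_alg L \o iota) g) (gam theta).
    by rewrite rootE -eval_polyE -gal_eval_poly -/ev g0 rmorph0.
  rewrite gT -(big_map (fun i => ev (T i)) xpredT (fun z => 'X - z%:P)).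
  rewrite root_prod_XsubC => /mapP[i _ gam_th].
  apply/cycleP; exists i; apply/permP => j; apply: x_inj.
  have := gamP j; rewrite gam_ev gam_th -/(ev _) eval_polyE -eval_poly_comp.
  by move/(ev_inj_res g0); rewrite (res_comp_frob _ (resT i)) !(PP _).2 frob_perm.
have [T [[Q gT] resT]] := frob_lift_exists i.
have [gam galgam gam_th] : exists2 gam, gam \in 'Gal({:L} / 1%AS)%g & gam theta = ev T.
  apply: normalField_root_minPoly; rewrite ?sub1v ?normalFieldf ?memvf //.
  (* The lift [g] is irreducible over [K], so it is the minimal polynomial of theta and each of its
     roots is a Galois conjugate. *)
  have : minPoly 1 theta %= map_poly (in_alg L \o iota) g.
    rewrite map_poly_comp; have : minPoly 1 theta %| map_poly (in_alg L) (map_poly iota g).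
      apply: minPoly_dvdp; first by apply/polyOver1P; exists (map_poly iota g).
      by rewrite rootE -map_poly_comp -eval_polyE -/ev g0.
    have /polyOver1P[m mE] := minPolyOver 1 theta.
    rewrite mE dvdp_map eqp_map; apply: irreducible_iota_lift.2.
    by rewrite -(size_map_poly (in_alg L)) -mE size_minPoly eqSS -lt0n.
  by move/eqp_root->; rewrite rootE -eval_poly_comp gT rmorphM /= -/ev g0 mulr0.
exists gam => // j.
rewrite gam_ev gam_th eval_polyE -eval_poly_comp -/ev.
have : root (map_poly (in_alg L \o iota) f) (ev (P j \Po T)).
  have [[R fP] _] := PP j.
  by rewrite rootE -eval_poly_comp comp_polyA fP comp_polyM gT !rmorphM /= -/ev g0 !mulr0.
rewrite (ev_split g0 f_monic size_f x_inj PP).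
rewrite -(big_map (fun i => ev (P i)) xpredT (fun z => 'X - z%:P)) root_prod_XsubC.
case/mapP=> l _ evl; rewrite evl; congr (ev (P _)); apply: x_inj.
by have := ev_inj_res g0 evl; rewrite (res_comp_frob _ resT) !(PP _).2 frob_perm.
Qed.

End Factorization.
End LocalGalois.

Lemma irreducible_factor (F : fieldType) (p : {poly F}) : (1 < size p)%N ->
  exists2 r, irreducible_poly r & r %| p.
Proof.
have [m] := ubnP (size p); elim: m p => // m IHm p; rewrite ltnS => pm p_gt1.
have [irr|nirr] := pselect (irreducible_poly p); first by exists p.
have [r [sr rp nrp]] : exists r : {poly F}, [/\ size r != 1%N, r %| p & ~ (r %= p)].
  apply: contrapT => nex; apply: nirr; split=> // r sr rp.
  by apply: contrapT => nrp; apply: nex; exists r.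
have p0 : p != 0 by rewrite -size_poly_gt0 ltnW.
have r0 : r != 0 by apply: contraNneq p0 => r0; rewrite r0 dvd0p in rp.
have r_gt1 : (1 < size r)%N by rewrite ltn_neqAle eq_sym sr size_poly_gt0.
have rp_lt : (size r < size p)%N.
  rewrite ltn_neqAle dvdp_leq // andbT.
  by apply/negP => spr; apply: nrp; rewrite -dvdp_size_eqp.
have [r' irr' r'r] := IHm r (leq_trans rp_lt pm) r_gt1.
by exists r' => //; exact: dvdp_trans rp.
Qed.

Lemma root_extension (F : fieldType) (p : {poly F}) : (1 < size p)%N ->
  exists (E : fieldExtType F) (z : E), root (map_poly (in_alg E) p) z.
Proof.
move=> /irreducible_factor[r irr /dvdpP[s ->]].
have [E _ [z rz _]] := irredp_FAdjoin irr.
by exists E, z; rewrite rmorphM rootM rz orbT.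
Qed.

(** * The Galois group is generated by Frobenius *)

Section LocalGaloisGroup.
Variables (O : comNzRingType) (K : fieldType) (k : finFieldType).
Variables (iota : {rmorphism O -> K}) (red : {rmorphism O -> k}).
Hypothesis red_surj : forall y, exists a, red a = y.
Hypothesis iota_inj : injective iota.
Hypothesis iota_total : forall x : K,
  (exists a, iota a = x) \/ (exists2 a, iota a = x^-1 & red a = 0).
Hypothesis cadic : forall c, red c = 0 -> cadic_separated c /\ cadic_complete c.

(** Every splitting field of [f] contains a root theta of the lift [g], and there the roots of [f]
    are the values of the lifts at theta up to an order [t]; [gal_lifted_roots] then gives the
    group. Conversely K(theta) itself is a splitting field. *)
Lemma has_galois_group_frobenius (kk : fieldExtType k) (n : nat)
    (f : {poly O}) (x : 'I_n -> kk) (sigma : 'S_n) (G : {group 'S_n}) :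
  f \is monic -> injective x ->
  map_poly (in_alg kk \o red) f = \prod_i ('X - (x i)%:P) ->
  (forall i, x i ^+ #|k| = x (sigma i)) ->
  has_galois_group (map_poly iota f) G <->
  exists t : 'S_n, <[sigma]>%g = (G :^ t)%g :> {set 'S_n}.
Proof.
move=> f_monic x_inj fE x_frob.
have size_f : size f = n.+1.
  have <- : size (map_poly (in_alg kk \o red) f) = size f.
    by rewrite size_map_poly_id0 // (monicP f_monic) rmorph1 oner_eq0.
  by rewrite fE size_prod_XsubC /index_enum -enumT size_enum_ord.
have [th th_gen] : exists th, <<1 & codom x>>%VS = <<1; th>>%VS.
  exists (separable_generator 1 <<1 & codom x>>).
  apply: eq_adjoin_separable_generator; last exact: sub1v.
  apply/separableP => y _; have := separable_root_der 1%AS y.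
  by rewrite rootE (negPf (deriv_minPoly_neq0 y)) addbF.
have th_x : th \in <<1 & codom x>>%VS by rewrite th_gen memv_adjoin.
have x_th i : x i \in <<1; th>>%VS.
  by rewrite -th_gen seqv_sub_adjoin // codom_f.
have /polyOver1P[gbar gbarE] := minPolyOver 1 th.
have gbar_monic : gbar \is monic.
  by rewrite -(map_monic (in_alg kk)) -gbarE monic_minPoly.
have [g [g_red g_monic size_g]] := red_monic_surj red_surj gbar_monic.
have gE : map_poly (in_alg kk \o red) g = minPoly 1 th.
  by rewrite map_poly_comp g_red gbarE.
have /fin_all_exists[P PP] := lifted_root_exists red_surj iota_inj iota_total
  cadic g_monic gE x_inj fE x_th.
have main (L : splittingFieldType K) (r : n.-tuple L) :
    map_poly (in_alg L) (map_poly iota f) = \prod_(z <- r) ('X - z%:P) ->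
    exists t : 'S_n, galois_perms r = (<[sigma]> :^ t)%g.
  move=> fr; have size_gL : (1 < size (map_poly (in_alg L \o iota) g))%N.
    rewrite size_map_poly_id0 ?(monicP g_monic) ?rmorph1 ?oner_eq0 //.
    exact: size_lift_gt1 gE.
  (* The root of [g] is first found in an extension [E] of [L]. *)
  have [E [z gz]] := root_extension size_gL.
  pose jE := in_alg E \o in_alg L.
  have gz0 : eval_poly (jE \o iota) z g = 0.
    by apply/eqP; move: gz; rewrite rootE -map_poly_comp.
  have evE y R : in_alg E (eval_poly (in_alg L \o iota) y R) =
      eval_poly (jE \o iota) (in_alg E y) R.
    by rewrite !eval_polyE -horner_map -map_poly_comp.
  have fz := ev_split iota_inj iota_total g_monic gE gz0 f_monic size_f
     x_inj PP.
  have [t tP] : exists t : 'S_n,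
      forall i, eval_poly (jE \o iota) z (P i) = in_alg E (tnth r (t i)).
    have : perm_eq [tuple eval_poly (jE \o iota) z (P i) | i < n]
                   [tuple in_alg E (tnth r i) | i < n].
      apply: prod_XsubC_eq; rewrite !big_map /= -enumT !big_enum /= -fz.
      rewrite (map_poly_comp (in_alg E)) map_poly_comp fr map_prod_XsubC.
      by rewrite big_tuple.
    case/tuple_permP=> t tE; exists t => i.
    have /(congr1 (fun s => tnth s i)) := val_inj tE.
    by rewrite !tnth_mktuple.
  (* The root descends to [L]: the lifted roots of [f] lie in [L], which is the subfield 1 of [E],
     so [lift_in_subfield] applies. *)
  have [y yz] : exists y, in_alg E y = z.
    suff /vlineP[y yE] : z \in 1%AS by exists y.
    apply: (lift_in_subfield red_surj iota_inj iota_total cadic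
      g_monic gE th_x PP (U := 1%AS) gz0) => [a|i].
      by rewrite rpredZ ?mem1v.
    by rewrite tP rpredZ ?mem1v.
  have gy0 : eval_poly (in_alg L \o iota) y g = 0.
    by apply: (fmorph_inj (in_alg E)); apply: etrans (evE _ _) _; rewrite yz gz0 rmorph0.
  have yP i : eval_poly (in_alg L \o iota) y (P i) = tnth r (t i).
    by apply: (fmorph_inj (in_alg E)); apply: etrans (evE _ _) _; rewrite yz tP.
  exists t; apply/setP => s; rewrite mem_conjg.
  have galP := gal_lifted_roots red_surj iota_inj iota_total cadic g_monic gE
    f_monic size_f x_inj x_frob PP (s ^ t^-1)%g gy0.
  (* Numbering the roots by [r] instead of by the lifts conjugates permutations by [t]. *)
  have conj i : t ((s ^ t^-1)%g i) = s (t i).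
    by rewrite /conjg invgK !permM permKV.
  apply/idP/idP => [|/galP[gam Ggam gamP]].
    rewrite inE => /existsP[gam /andP[Ggam /forallP gamP]]; apply/galP.
    by exists gam => // i; rewrite !yP conj; apply/eqP.
  rewrite inE; apply/existsP; exists gam; rewrite Ggam /=.
  apply/forallP => i; rewrite -(permKV t i).
  by have := gamP ((t^-1)%g i); rewrite !yP conj => ->.
split=> [[L [r [fr _ [s rG]]]]|[t sG]].
  have [t rs] := main L r fr; exists (s * t^-1)%g.
  by rewrite conjsgM -rG rs conjsgK.
(* The splitting field for the converse is M = K(theta), and the roots of [f] generate it, again by
   [lift_in_subfield]. *)
have [M _ [z gz z_gen]] :=
  irredp_FAdjoin (irreducible_iota_lift iota_inj iota_total g_monic gE).
have gz0 : eval_poly (in_alg M \o iota) z g = 0.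
  by apply/eqP; move: gz; rewrite rootE -map_poly_comp.
have fz := ev_split iota_inj iota_total g_monic gE gz0 f_monic size_f
   x_inj PP.
pose r := [tuple eval_poly (in_alg M \o iota) z (P i) | i < n].
have fr : map_poly (in_alg M) (map_poly iota f) = \prod_(y <- r) ('X - y%:P).
  by rewrite -map_poly_comp fz /r big_map /= big_enum.
have r_gen : <<1 & r>>%VS = fullv.
  apply/eqP; rewrite eqEsubv subvf -z_gen -[(_ <= _)%VS]/(<<1; z>>%AS <= _)%VS.
  apply/FadjoinP; split; first exact: sub1v.
  apply: (lift_in_subfield red_surj iota_inj iota_total cadic
      g_monic gE th_x PP gz0) => [a|i].
    by rewrite rpredZ ?mem1v.
  by rewrite seqv_sub_adjoin //; apply/mapP; exists i; rewrite ?mem_enum.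
have split_ax : splitting_field_axiom M.
  exists (map_poly (in_alg M) (map_poly iota f)).
    by apply/polyOver1P; exists (map_poly iota f).
  by exists r; rewrite ?fr ?eqpxx.
pose L : splittingFieldType K :=
  HB.pack_for (splittingFieldType K) M (FieldExt_isSplittingField.Build K M split_ax).
have [t' rs] := main L r fr.
exists L, r; split=> //; exists (t * t')%g.
by rewrite rs sG conjsgM.
Qed.

End LocalGaloisGroup.

(** * Cycle types *)

Section CycleType.
Variable n : nat.
Implicit Types (s t u : 'S_n).

Lemma porbit_gen s t : <[s]>%g = <[t]>%g -> porbit s =1 porbit t.
Proof. by move=> st x; rewrite porbit.unlock st. Qed.

Lemma cycle_type_gen s t : <[s]>%g = <[t]>%g -> cycle_type s = cycle_type t.
Proof.
move=> st; rewrite /cycle_type; suff -> : porbits s = porbits t by [].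
by apply: eq_imset => x; exact: porbit_gen.
Qed.

Lemma porbit_conj s u x : porbit (s ^ u)%g (u x) = u @: porbit s x.
Proof.
apply/setP => y; apply/porbitP/imsetP => [[i ->]|[z /porbitP[i ->] ->]].
  exists ((s ^+ i)%g x); first exact: mem_porbit.
  by rewrite -conjXg /conjg !permM permK.
by exists i; rewrite -conjXg /conjg !permM permK.
Qed.

Lemma porbits_conj s u : porbits (s ^ u)%g = [set u @: (c : {set 'I_n}) | c in porbits s].
Proof.
apply/setP => c; apply/imsetP/imsetP => [[x _ ->]|[_ /imsetP[x _ ->] ->]].
  exists (porbit s ((u^-1)%g x)); first exact: imset_f.
  by rewrite -porbit_conj permKV.
by exists (u x); rewrite ?porbit_conj.
Qed.

Lemma cycle_type_conj s u : cycle_type (s ^ u)%g = cycle_type s.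
Proof.
apply/perm_sortP => [x y|x y z /=|x y /=|].
- exact: leq_total.
- by move=> yx zy; exact: leq_trans yx.
- by rewrite andbC -eqn_leq => /eqP.
have u_inj : injective (fun c : {set 'I_n} => u @: c) by apply/imset_inj/perm_inj.
have card_u : (fun c : {set 'I_n} => #|u @: c|) =1 (fun c : {set 'I_n} => #|c|).
  by move=> c; rewrite card_imset //; apply: perm_inj.
have /(perm_map (fun c : {set 'I_n} => #|c|)) : perm_eq (enum (porbits (s ^ u)%g))
    [seq u @: (c : {set 'I_n}) | c <- enum (porbits s)].
  apply: uniq_perm; rewrite ?enum_uniq ?map_inj_uniq ?enum_uniq // porbits_conj.
  move=> c; rewrite mem_enum; apply/idP/idP => [/imsetP[c' c's ->]|/mapP[c' c's ->]].
    by rewrite map_f // mem_enum.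
  by rewrite imset_f // -mem_enum.
by rewrite -map_comp (eq_map card_u).
Qed.

(** This reduces equalities between powers at a point to congruences modulo the cycle length, so
    they transfer between cycles of equal length. *)
Lemma porbit_expg_eq s x i j :
  ((s ^+ i)%g x == (s ^+ j)%g x) = (i == j %[mod #|porbit s x|]).
Proof.
set m := #|_|; have m_gt0 : (0 < m)%N by rewrite lt0n card_porbit_neq0.
have sm : (s ^+ m)%g x = x by rewrite permX iter_porbit.
have mod_exp l : (s ^+ l)%g x = nth x (traject s x m) (l %% m).
  rewrite nth_traject ?ltn_pmod // {1}(divn_eq l m) expgD permM -permX.
  congr ((s ^+ _)%g _); elim: (l %/ m)%N => [|a IHa].
    by rewrite mul0n expg0 perm1.
  by rewrite mulSn expgD permM sm.
rewrite !mod_exp nth_uniq ?size_traject ?ltn_pmod //.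
exact: uniq_traject_porbit.
Qed.

(** Cycles of equal length are matched, a base point is chosen in each, and s^i(base) is sent to
    t^i(base). *)
Lemma cycle_type_inj_conj s t :
  cycle_type s = cycle_type t -> exists u : 'S_n, t = (s ^ u)%g.
Proof.
move=> st; have : perm_eq [seq #|(c : {set 'I_n})| | c in porbits s]
    [seq #|(c : {set 'I_n})| | c in porbits t].
  by rewrite -(perm_sort geq) -/(cycle_type s) st perm_sort.
set card := fun c : {set 'I_n} => #|c|; rewrite /image_mem -/card.
set ls := enum _; set lt := enum (porbits t).
(* The indices [Is] reorder the cycles of [t] so that the two lists of lengths agree entry by
   entry. *)
case/(perm_iotaP 0%N) => Is pIs cardIs; rewrite size_map in pIs.
have {cardIs} cardIs : map card ls = map card [seq nth finset.set0 lt i | i <- Is].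
  rewrite cardIs -map_comp; apply/eq_in_map => i.
  by rewrite (perm_mem pIs) mem_iota add0n => /andP[_ lti]; rewrite (nth_map finset.set0).
move: cardIs; set lt' := map _ Is.
have lt'_perm : perm_eq lt' lt.
  by apply/(perm_iotaP finset.set0); exists Is.
move=> cards; have size_ls : size ls = size lt'.
  by have /(congr1 size) := cards; rewrite 2!size_map.
pose beta c := nth finset.set0 lt' (index c ls).
have mem_ls x : porbit s x \in ls by rewrite mem_enum imset_f.
have lt_ls x : (index (porbit s x) ls < size ls)%N by rewrite index_mem.
have beta_porbit x : exists y, porbit t y = beta (porbit s x).
  have : beta (porbit s x) \in lt' by rewrite mem_nth // -size_ls.
  by rewrite (perm_mem lt'_perm) mem_enum => /imsetP[y _ ->]; exists y.
have card_beta x : #|beta (porbit s x)| = #|porbit s x|.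
  rewrite -[LHS]/(card _) /beta -(nth_map finset.set0 0%N) -?size_ls //.
  by rewrite -cards (nth_map finset.set0) // nth_index.
have beta_inj x y : beta (porbit s x) = beta (porbit s y) -> porbit s x = porbit s y.
  move/eqP; rewrite nth_uniq -?size_ls // ?(perm_uniq lt'_perm) ?enum_uniq //.
  by move/eqP/(congr1 (nth finset.set0 ls)); rewrite !nth_index.
(* The choice depends only on the orbit, so all points of a cycle share one base point; the default
   never occurs, as the orbit contains [x]. *)
pose rep x := odflt x [pick y in porbit s x].
have repP x : porbit s (rep x) = porbit s x.
  apply/eqP; rewrite eq_porbit_mem /rep; case: pickP => //= /(_ x).
  by rewrite porbit_id.
have rep_eq x y : porbit s x = porbit s y -> rep x = rep y.
  rewrite /rep => xy; rewrite -xy; case: pickP => //= /(_ x).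
  by rewrite porbit_id.
pose w x := odflt x [pick y | porbit t y == beta (porbit s x)].
have wP x : porbit t (w x) = beta (porbit s x).
  rewrite /w; case: pickP => [y /eqP //|]; have [y yx] := beta_porbit x.
  by move=> /(_ y); rewrite yx eqxx.
have w_eq x y : porbit s x = porbit s y -> w x = w y.
  rewrite /w => xy; rewrite -xy; case: pickP => //= w0; have [z zx] := beta_porbit x.
  by have := w0 z; rewrite zx eqxx.
have /fin_all_exists[k kP] (x : 'I_n) : exists i, x = (s ^+ i)%g (rep x).
  by apply/porbitP; rewrite -eq_porbit_mem repP.
(* The exponent [k x] is arbitrary modulo the cycle length, which is harmless because the matched
   cycle of [t] has the same length. *)
pose h x := (t ^+ k x)%g (w x).
have h_porbit x : porbit t (h x) = beta (porbit s x) by rewrite porbit_perm wP.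
have h_inj : injective h.
  move=> x y hxy; have xy : porbit s x = porbit s y.
    by apply: beta_inj; rewrite -!h_porbit hxy.
  move/eqP: hxy; rewrite /h (w_eq _ _ xy) porbit_expg_eq wP card_beta -repP.
  by rewrite -porbit_expg_eq -kP -(rep_eq _ _ xy) -kP => /eqP.
have hs x : h (s x) = t (h x).
  have sx : porbit s (s x) = porbit s x by apply/eqP; rewrite eq_porbit_mem (mem_porbit s 1).
  rewrite /h (w_eq _ _ sx) -permM -expgSr; apply/eqP.
  rewrite porbit_expg_eq wP card_beta -repP -porbit_expg_eq.
  by rewrite expgSr permM -kP -(rep_eq _ _ sx) -kP.
exists (perm h_inj); apply/permP => y; rewrite -(permKV (perm h_inj) y).
by rewrite /conjg !permM permK !permE hs.
Qed.

(** Generators of one cyclic group share their cycle type, and permutations of one cycle type are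
    conjugate. If [G] is not cyclic, both sides vanish. *)
Lemma card_cycle_class_generator (G : {group 'S_n}) :
  (if [pick s | generator G s] is Some s then #|cycle_class n (cycle_type s)| else 0%N)
  = #|[set s : 'S_n | [exists t : 'S_n, <[s]>%g == (G :^ t)%g]]|.
Proof.
case: pickP => [s /eqP Gs|Gn].
  apply: eq_card => u; rewrite !inE; apply/eqP/existsP => [us|[t /eqP ut]].
    have [t ->] := cycle_type_inj_conj (esym us).
    by exists t; rewrite cycleJ Gs.
  by rewrite -(cycle_type_conj s t); apply: cycle_type_gen; rewrite ut Gs cycleJ.
apply/esym/eqP; rewrite cards_eq0; apply/eqP/setP => s; rewrite !inE.
apply/existsP => -[t /eqP st]; have := Gn (s ^ t^-1)%g.
by rewrite /generator cycleJ st conjsgK eqxx.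
Qed.

End CycleType.

(** * Counting polynomials over a finite field *)

Lemma size_monic_of_tuple (A : comNzRingType) n (a : n.-tuple A) :
  size (monic_of_tuple a) = n.+1.
Proof.
rewrite size_polyDl size_polyXn // ltnS.
by rewrite (leq_trans (size_sum _ _ _)) //; apply/bigmax_leqP => i _;
   rewrite (leq_trans (size_scale_leq _ _)) // size_polyXn.
Qed.

Lemma monic_of_tuple_monic (A : comNzRingType) n (a : n.-tuple A) :
  monic_of_tuple a \is monic.
Proof.
rewrite monicE lead_coefDl ?lead_coefXn // size_polyXn ltnS.
by rewrite (leq_trans (size_sum _ _ _)) //; apply/bigmax_leqP => i _;
   rewrite (leq_trans (size_scale_leq _ _)) // size_polyXn.
Qed.

Lemma coef_monic_of_tuple (A : comNzRingType) n (a : n.-tuple A) (i : 'I_n) :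
  (monic_of_tuple a)`_i = tnth a i.
Proof.
rewrite coefD coefXn (ltn_eqF (ltn_ord i)) add0r coef_sum (bigD1 i) //=.
rewrite coefZ coefXn eqxx mulr1 big1 ?addr0 // => j ji.
by rewrite coefZ coefXn eq_sym (inj_eq val_inj) (negPf ji) mulr0.
Qed.

Lemma monic_of_tuple_inj (A : comNzRingType) n : injective (@monic_of_tuple A n).
Proof.
by move=> a b ab; apply: eq_from_tnth => i; rewrite -!coef_monic_of_tuple ab.
Qed.

Lemma monic_of_tupleK (A : comNzRingType) n (f : {poly A}) :
  f \is monic -> size f = n.+1 -> monic_of_tuple [tuple f`_i | i < n] = f.
Proof.
move=> fm sf; apply/polyP => i; have [lt_in|le_ni] := ltnP i n.
  by rewrite (coef_monic_of_tuple _ (Ordinal lt_in)) tnth_mktuple.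
have [->|ni] := eqVneq i n.
  have := monicP (monic_of_tuple_monic [tuple f`_i | i < n]).
  by rewrite !lead_coefE size_monic_of_tuple => ->; have := monicP fm;
     rewrite lead_coefE sf => ->.
by rewrite !nth_default ?size_monic_of_tuple ?sf // ltn_neqAle eq_sym ni.
Qed.

Lemma map_monic_of_tuple (A B : comNzRingType) (h : {rmorphism A -> B}) n
    (a : n.-tuple A) :
  map_poly h (monic_of_tuple a) = monic_of_tuple (map_tuple h a).
Proof.
rewrite rmorphD /= map_polyXn rmorph_sum /=; congr (_ + _).
by apply: eq_bigr => i _; rewrite map_polyZ /= map_polyXn tnth_map.
Qed.

Lemma sum_card_porbits n (s : 'S_n) :
  (\sum_(c in porbits s) #|(c : {set 'I_n})|)%N = n.
Proof.
rewrite -[RHS]card_ord -sum1_card (partition_big (porbit s) (mem (porbits s))) /=; last first.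
  by move=> i _; exact: imset_f.
apply: eq_bigr => c /imsetP[x _ ->]; rewrite -sum1_card; apply: eq_bigl => i.
by rewrite /= eq_porbit_mem.
Qed.

(** There are finitely many polynomials of degree [n], so their product has one splitting field
    serving all of them. [finvect_type] makes it finite, so that root tuples can be counted. *)
Lemma splitting_extension (k : finFieldType) n :
  exists L : fieldExtType k, forall c : n.-tuple k,
  exists x : {ffun 'I_n -> finvect_type L},
    map_poly (in_alg (finvect_type L)) (monic_of_tuple c)
    = \prod_i ('X - (x i)%:P).
Proof.
pose p : {poly k} := \prod_(c : n.-tuple k) monic_of_tuple c.
have p0 : p != 0.
  by apply/prodf_neq0 => c _; exact/monic_neq0/monic_of_tuple_monic.
have [L [rs pE _]] := FinSplittingFieldFor p0; exists L => c.
have : map_poly (in_alg L) (monic_of_tuple c) %| \prod_(z <- rs) ('X - z%:P).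
  by rewrite -(eqp_dvdr _ pE) dvdp_map /p (bigD1 c) //= dvdp_mulIl.
case/dvdp_prod_XsubC=> b; set s := mask b rs => cE.
have {}cE : map_poly (in_alg L) (monic_of_tuple c) = \prod_(z <- s) ('X - z%:P).
  apply/eqP; rewrite -eqp_monic ?monic_prod_XsubC // map_monic.
  exact: monic_of_tuple_monic.
have sz_s : size s == n.
  by rewrite -eqSS -(size_prod_XsubC s id) -cE size_map_poly size_monic_of_tuple.
exists [ffun i => tnth (Tuple sz_s) i].
transitivity (\prod_(z <- Tuple sz_s) ('X - z%:P)); first exact: cE.
rewrite big_tuple; apply: eq_bigr => i _; by rewrite ffunE.
Qed.

Section Counting.
Variables (k : finFieldType) (L : fieldExtType k) (n : nat).
Local Notation q := #|k|.
Local Notation kk := (finvect_type L).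
Hypothesis splits : forall c : n.-tuple k, exists x : {ffun 'I_n -> kk},
  map_poly (in_alg kk) (monic_of_tuple c) = \prod_i ('X - (x i)%:P).
Implicit Types (x : {ffun 'I_n -> kk}) (s t u : 'S_n) (c : n.-tuple k)
  (T : {set 'S_n}).

(** These are the orderings of the roots of separable polynomials over [k] for which Frobenius acts
    as [s]. *)
Definition frob_tuples s : {set {ffun 'I_n -> kk}} :=
  [set x : {ffun 'I_n -> kk} | injectiveb x && [forall i, x i ^+ q == x (s i)]].

Lemma frob_tuplesP s x :
  reflect (injective x /\ forall i, x i ^+ q = x (s i)) (x \in frob_tuples s).
Proof.
rewrite inE; apply: (iffP andP) => -[/injectiveP xi xs]; split => //.
  by move=> i; apply/eqP; exact: (forallP xs).
by apply/forallP => i; apply/eqP.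
Qed.

Lemma frob_tuples_perm s x i j : x \in frob_tuples s ->
  x j ^+ (q ^ i) = x ((s ^+ i)%g j).
Proof.
case/frob_tuplesP=> _ xs; elim: i => [|i IHi].
  by rewrite expg0 perm1 expn0 expr1.
by rewrite expgSr permM expnSr exprM IHi xs.
Qed.

Lemma card_frob_fixed e : (0 < e)%N ->
  (#|[set y : kk | y ^+ (q ^ e) == y]| <= q ^ e)%N.
Proof.
move=> e_gt0; have q_gt1 := finNzRing_gt1 k.
have size_qe : size ('X^(q ^ e) - 'X : {poly kk}) = (q ^ e).+1.
  rewrite size_polyDl size_polyXn // size_polyN size_polyX ltnS.
  by rewrite -[X in (X < _)%N](exp1n e) ltn_exp2r.
rewrite cardE -ltnS -size_qe; apply: max_poly_roots; rewrite ?enum_uniq //.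
  by rewrite -size_poly_eq0 size_qe.
apply/allP => y; rewrite mem_enum inE => /eqP yq.
by rewrite rootE !hornerE yq subrr.
Qed.

(** The value at one point of a cycle of length m determines the values on that cycle and satisfies
    y^(q^m) = y, so it has at most q^m choices. The lengths add up to [n]. *)
Lemma card_frob_tuples s : (#|frob_tuples s| <= q ^ n)%N.
Proof.
(* [F] records one value per cycle; sets that are not cycles get the filler 0, so the image lies in
   a [pfamily]. *)
pose F (x : {ffun 'I_n -> kk}) : {ffun {set 'I_n} -> kk} := [ffun c : {set 'I_n} =>
  (if [pick i in c] is Some i then (if c \in porbits s then x i else 0) else 0) : kk].
pose fix_ (c : {set 'I_n}) := [set y : kk | y ^+ (q ^ #|c|) == y].
have F_inj : {in frob_tuples s &, injective F}.
  move=> x y xs ys /ffunP Fxy; apply/ffunP => i; move: (Fxy (porbit s i)).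
  rewrite !ffunE; case: pickP => [j ji|/(_ i)]; last by rewrite porbit_id.
  rewrite imset_f // => xyj.
  move: ji; rewrite porbit_sym => /porbitP[l ->].
  by rewrite -(frob_tuples_perm l j xs) -(frob_tuples_perm l j ys) xyj.
rewrite -(card_in_imset F_inj).
apply: (@leq_trans #|pfamily (0 : kk) (mem (porbits s)) fix_|).
  apply/subset_leq_card/fintype.subsetP => _ /imsetP[x xs ->].
  apply/pfamilyP; split=> [|c cs].
    apply/fintype.subsetP => c; rewrite inE ffunE; case: pickP => [i _|_]; last by rewrite eqxx.
    by case: ifP => // _; rewrite eqxx.
  rewrite ffunE; case: pickP => [i ci|c0]; last first.
    by case/imsetP: cs c0 => i _ -> /(_ i); rewrite porbit_id.
  rewrite cs inE (frob_tuples_perm _ _ xs); apply/eqP; congr (x _).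
  case/imsetP: cs ci => j _ ->; rewrite -eq_porbit_mem => /eqP <-.
  by rewrite permX iter_porbit.
rewrite card_pfamily foldrE big_map big_enum /=.
rewrite -[X in (_ <= _ ^ X)%N](sum_card_porbits s) expn_sum.
apply: leq_prod => c /imsetP[i _ ->]; apply: card_frob_fixed.
by rewrite lt0n card_porbit_neq0.
Qed.

Definition frob_polys (T : {set 'S_n}) : {set n.-tuple k} :=
  [set c : n.-tuple k | [exists x : {ffun 'I_n -> kk}, [exists s in T, (x \in frob_tuples s) &&
     (map_poly (in_alg kk) (monic_of_tuple c) == \prod_i ('X - (x i)%:P))]]].

Lemma frob_polysP T c :
  reflect (exists (x : {ffun 'I_n -> kk}) s, [/\ s \in T, x \in frob_tuples s &
     map_poly (in_alg kk) (monic_of_tuple c) = \prod_i ('X - (x i)%:P)])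
  (c \in frob_polys T).
Proof.
rewrite inE; apply: (iffP existsP) => [[x /existsP[s /and3P[sT xs /eqP cx]]]|].
  by exists x, s.
case=> x [s [sT xs cx]]; exists x; apply/existsP; exists s.
by rewrite sT xs cx eqxx.
Qed.

Lemma prod_XsubC_ffun (E : fieldType) (x y : {ffun 'I_n -> E}) :
  \prod_i ('X - (x i)%:P) = \prod_i ('X - (y i)%:P) ->
  exists u : 'S_n, y = [ffun i => x (u i)].
Proof.
move=> xy; have : perm_eq [tuple y i | i < n] [tuple x i | i < n].
  by apply: prod_XsubC_eq; rewrite !big_map /= -enumT !big_enum xy.
case/tuple_permP=> u uE; exists u; apply/ffunP => i; rewrite ffunE.
have /(congr1 (fun w : n.-tuple E => tnth w i)) := val_inj uE.
by rewrite !tnth_mktuple.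
Qed.

Lemma frob_tuples_uniq s t x : x \in frob_tuples s -> x \in frob_tuples t -> s = t.
Proof.
move=> /frob_tuplesP[xi xs] /frob_tuplesP[_ xt]; apply/permP => i.
by apply: xi; rewrite -xs xt.
Qed.

(** Frobenius permutes the linear factors, so it fixes the coefficients of the product, which
    therefore lie in [k]. *)
Lemma frob_tuples_poly s x : x \in frob_tuples s ->
  exists c, map_poly (in_alg kk) (monic_of_tuple c) = \prod_i ('X - (x i)%:P).
Proof.
case/frob_tuplesP=> xi xs; set p := \prod_i _.
have p_monic : p \is monic by rewrite monic_prod_XsubC.
have size_p : size p = n.+1.
  by rewrite size_prod_XsubC /index_enum -enumT size_enum_ord.
have pq i : p`_i ^+ q = p`_i.
  have : map_poly (frob 1) p = p.
    rewrite map_prod_XsubC [RHS](reindex_inj (perm_inj (s := s))) /=.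
    by apply: eq_bigr => j _; rewrite /frob expn1 xs.
  by move/(congr1 (fun r : {poly kk} => r`_i)); rewrite coef_map /= /frob expn1.
have /polyOver1P[r rE] : p \is a polyOver 1%VS.
  apply/polyOverP => i.
  have := Fermat's_little_theorem (1%AS : {subfield kk}) p`_i.
  by rewrite dimv1 expn1 pq eqxx.
have r_monic : r \is monic by rewrite -(map_monic (in_alg kk)) -rE.
exists [tuple r`_i | i < n]; rewrite monic_of_tupleK //.
by rewrite -(size_map_poly (in_alg kk)) -rE.
Qed.

Lemma frob_polys_all c : (c \in frob_polys [set: 'S_n]) = separable_poly (monic_of_tuple c).
Proof.
have [x cx] := splits c.
rewrite -(separable_map (in_alg kk)) cx.
have -> : separable_poly (\prod_i ('X - (x i)%:P)) = injectiveb x.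
  by rewrite -(big_map x xpredT (fun z => 'X - z%:P)) separable_prod_XsubC
     /index_enum -enumT.
apply/frob_polysP/injectiveP => [[y [s [_ /frob_tuplesP[yi ys] cy]]]|xi].
  have [u ->] := prod_XsubC_ffun (etrans (esym cy) cx).
  by move=> i j; rewrite !ffunE => /yi/perm_inj.
have /fin_all_exists[s sE] : forall i, exists j, x i ^+ q = x j.
  move=> i; have : root (map_poly (in_alg kk) (monic_of_tuple c)) (x i ^+ (q ^ 1)).
    rewrite rootE -frob_horner_alg cx.
    by rewrite (bigD1 i) //= !hornerE subrr mul0r frob0.
  rewrite cx -(big_map x xpredT (fun z => 'X - z%:P)) root_prod_XsubC.
  by rewrite expn1 => /mapP[j _ ->]; exists j.
have s_inj : injective s.
  move=> i j ij; apply: xi; apply: (@frob_inj _ _ 1).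
  by rewrite /= expn1 !sE ij.
exists x, (perm s_inj); split; [exact: finset.in_setT | | exact: cx].
by apply/frob_tuplesP; split=> // i; rewrite permE.
Qed.

(* Each polynomial counted on the left has n! orderings of its roots, and each
   ordering belongs to exactly one s. *)
Lemma card_frob_polys T : (forall s t, s \in T -> (s ^ t)%g \in T) ->
  (n`! * #|frob_polys T| = \sum_(s in T) #|frob_tuples s|)%N.
Proof.
move=> TJ; pose NT := [set x : {ffun 'I_n -> kk} | [exists s in T, x \in frob_tuples s]].
have NTP (x : {ffun 'I_n -> kk}) :
    reflect (exists2 s, s \in T & x \in frob_tuples s) (x \in NT).
  by rewrite inE; apply: exists_inP.
pose sg (x : {ffun 'I_n -> kk}) := odflt 1%g [pick s | x \in frob_tuples s].
have sgE (s : 'S_n) x : x \in frob_tuples s -> sg x = s.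
  rewrite /sg; case: pickP => [t xt xs|/(_ s) -> //].
  exact: frob_tuples_uniq xt xs.
transitivity #|NT|; last first.
  rewrite -sum1_card (partition_big sg (mem T)) /=; last first.
    by move=> x /NTP[s sT /sgE ->].
  apply: eq_bigr => s sT; rewrite sum1_card; apply: eq_card => x.
  rewrite unfold_in; apply/andP/idP => [[/NTP[t _ xt] /eqP <-]|xs].
    by rewrite (sgE t).
  by split; [apply/NTP; exists s | apply/eqP/sgE].
pose psi (x : {ffun 'I_n -> kk}) := odflt [tuple 0 | i < n]
  [pick c : n.-tuple k |
     map_poly (in_alg kk) (monic_of_tuple c) == \prod_i ('X - (x i)%:P)].
have psiP (x : {ffun 'I_n -> kk}) s : x \in frob_tuples s ->
    map_poly (in_alg kk) (monic_of_tuple (psi x)) = \prod_i ('X - (x i)%:P).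
  move=> /frob_tuples_poly[c cx]; rewrite /psi; case: pickP => [c' /eqP //|/(_ c)].
  by rewrite cx eqxx.
have psi_eq c (x : {ffun 'I_n -> kk}) s : x \in frob_tuples s ->
    map_poly (in_alg kk) (monic_of_tuple c) = \prod_i ('X - (x i)%:P) -> psi x = c.
  move=> /psiP; move=> <- /map_poly_inj/esym; exact: monic_of_tuple_inj.
rewrite -[RHS]sum1_card (partition_big psi (mem (frob_polys T))) /=; last first.
  by move=> x /NTP[s sT xs]; apply/frob_polysP; exists x, s; rewrite (psiP _ _ xs).
rewrite mulnC -sum_nat_const; apply: eq_bigr => c.
case/frob_polysP=> x [s [sT xs cx]]; have /frob_tuplesP[xi xf] := xs.
rewrite sum1_card -card_Sn.
have F_inj : injective (fun u : 'S_n => [ffun i => x (u i)]).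
  move=> u v /ffunP uv; apply/permP => i; have := uv i.
  by rewrite !ffunE => /xi.
rewrite -(card_codom F_inj); apply: eq_card => y; rewrite [in RHS]unfold_in.
apply/codomP/andP => [[u ->]|[/NTP[t tT yt] /eqP psiy]]; last first.
  apply: prod_XsubC_ffun; rewrite -cx -psiy; exact: psiP yt.
(* Reordering the roots by [u] conjugates the Frobenius permutation, which stays in [T] by [TJ];
   thus the fibre over [c] has n! elements. *)
have yu : [ffun i => x (u i)] \in frob_tuples (s ^ u^-1)%g.
  apply/frob_tuplesP; split=> [i j|i]; rewrite !ffunE; first by move/xi/perm_inj.
  by rewrite xf /conjg invgK !permM permKV.
split; first by apply/NTP; exists (s ^ u^-1)%g => //; exact: TJ.
apply/eqP; apply: (psi_eq _ _ _ yu); rewrite cx (reindex_inj (perm_inj (s := u))) /=.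
by apply: eq_bigr => i _; rewrite ffunE.
Qed.

End Counting.

Lemma monic_polyE (A : nzRingType) (p : {poly A}) m : p \is monic -> size p = m.+1 ->
  p = 'X^m + \poly_(i < m) p`_i.
Proof.
move=> pm sp; apply/polyP => i; rewrite coefD coefXn coef_poly.
case: (ltngtP i m) => [im|mi|->]; rewrite ?add0r ?addr0 //.
  by rewrite nth_default // sp.
by have := monicP pm; rewrite lead_coefE sp.
Qed.

(** * Inseparable polynomials are rare *)

Section Estimate.
Variables (k : finFieldType) (L : fieldExtType k) (n : nat).
Local Notation q := #|k|.
Local Notation kk := (finvect_type L).
Hypothesis splits : forall c : n.-tuple k, exists x : {ffun 'I_n -> kk},
  map_poly (in_alg kk) (monic_of_tuple c) = \prod_i ('X - (x i)%:P).

(* A double root y of f gives G = minPoly 1 y, whose square divides f since y is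
   a simple root of G. *)
Lemma inseparable_square (c : n.-tuple k) : ~~ separable_poly (monic_of_tuple c) ->
  exists G H : {poly k}, [/\ G \is monic, (1 < size G)%N &
    monic_of_tuple c = G ^+ 2 * H].
Proof.
set f := monic_of_tuple c; have [x fx] := splits c.
rewrite -(separable_map (in_alg kk)) fx -(big_map x xpredT (fun z => 'X - z%:P)).
rewrite separable_prod_XsubC /index_enum -enumT => /injectivePn[i [j ij xij]].
have /polyOver1P[G GE] := minPolyOver 1 (x i).
have [w fw] : exists w, map_poly (in_alg kk) f = ('X - (x i)%:P) ^+ 2 * w.
  rewrite fx (bigD1 i) //= (bigD1 j) 1?eq_sym //= -xij mulrA -expr2.
  by eexists.
have fi : root (map_poly (in_alg kk) f) (x i) by rewrite fw rootM root_exp_XsubC eqxx.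
have G_dvd (p : {poly k}) : root (map_poly (in_alg kk) p) (x i) -> G %| p.
  move=> pi; rewrite -(dvdp_map (in_alg kk)) -GE minPoly_dvdp //.
  by apply/polyOver1P; exists p.
have /dvdpP[r fr] := G_dvd f fi.
have /dvdpP[s rs] : G %| r.
  apply: G_dvd; have : (map_poly (in_alg kk) f)^`().[x i] = 0.
    by rewrite fw expr2 !derivM !(hornerD, hornerN, hornerM, hornerX, hornerC); ring.
  rewrite fr rmorphM /= derivM -GE hornerD !hornerM minPolyxx mulr0 add0r.
  by move/eqP; rewrite mulf_eq0 (negPf (deriv_minPoly_neq0 _)) orbF.
exists G, s; split.
- by rewrite -(map_monic (in_alg kk)) -GE monic_minPoly.
- by rewrite -(size_map_poly (in_alg kk)) -GE size_minPoly ltnS.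
- by rewrite fr rs; ring.
Qed.

(** If f = G^2 H with deg G = d+1, then G and H have n-(d+1) free coefficients together. They fit
    into one tuple of length n-1, and [d] has at most [n] values. *)
Lemma card_inseparable :
  (#|[set c : n.-tuple k | ~~ separable_poly (monic_of_tuple c)]| <= n * q ^ n.-1)%N.
Proof.
(* The first d+1 entries of [t] are the lower coefficients of G, and those of H start at index
   d+1. *)
pose G d (t : n.-1.-tuple k) : {poly k} := 'X^(d.+1) + \poly_(i < d.+1) t`_i.
pose H d (t : n.-1.-tuple k) : {poly k} :=
  'X^(n - d.+1.*2) + \poly_(i < n - d.+1.*2) t`_(d.+1 + i).
pose F (dt : 'I_n * n.-1.-tuple k) : n.-tuple k :=
  [tuple (G dt.1 dt.2 ^+ 2 * H dt.1 dt.2)`_i | i < n].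
have -> : (n * q ^ n.-1 = #|{: 'I_n * n.-1.-tuple k}|)%N.
  by rewrite card_prod card_ord card_tuple.
rewrite -cardsT; apply: leq_trans (leq_imset_card F _).
apply/subset_leq_card/fintype.subsetP => c; rewrite inE => /inseparable_square.
move=> [g [h [gm g_gt1 cE]]].
have cm := monic_of_tuple_monic c.
have hm : h \is monic by rewrite -(monicMl _ (monic_exp 2 gm)) -cE.
have [d sg] : exists d, size g = d.+2 by case: (size g) g_gt1 => [|[|d]] // _; exists d.
have := size_monic_of_tuple c; rewrite cE size_Mmonic ?monic_neq0 ?monic_exp //.
rewrite expr2 size_Mmonic ?monic_neq0 // sg !addnS !addSn /= => - [sgh].
have h_gt0 : (0 < size h)%N by rewrite size_poly_gt0 monic_neq0.
have [m sh] : exists m, size h = m.+1 by exists (size h).-1; rewrite prednK.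
rewrite sh in sgh; have dn : (d.+1.*2 <= n)%N by lia.
have {}sh : size h = (n - d.+1.*2).+1 by rewrite sh; lia.
have lt_dn : (d < n)%N by lia.
pose t : n.-1.-tuple k :=
  [tuple if (i < d.+1)%N then g`_i else h`_(i - d.+1) | i < n.-1].
apply/imsetP; exists (Ordinal lt_dn, t) => //.
apply: monic_of_tuple_inj; rewrite /F /=.
have tE i : (i < n.-1)%N -> t`_i = if (i < d.+1)%N then g`_i else h`_(i - d.+1).
  by move=> lt_in; have := tnth_nth 0 t (Ordinal lt_in); rewrite tnth_mktuple => <-.
have -> : G d t = g.
  rewrite [RHS](monic_polyE gm sg); congr (_ + _); apply: eq_poly => i id.
  by rewrite tE ?id //; lia.
have -> : H d t = h.
  rewrite [RHS](monic_polyE hm sh); congr (_ + _); apply: eq_poly => i id.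
  by rewrite tE ?ltnNge ?leq_addr /= ?addKn //; lia.
by rewrite -cE monic_of_tupleK // size_monic_of_tuple.
Qed.

(** The upper bound sums [card_frob_tuples] over [T]. For the lower bound, the same estimate on the
    complement of [T] is subtracted from the count of all separable polynomials. *)
Lemma frob_polys_bounds (T : {set 'S_n}) : (forall s t, s \in T -> (s ^ t)%g \in T) ->
  (n`! * #|frob_polys L T| <= #|T| * q ^ n)%N /\
  (#|T| * q ^ n <= n`! * #|frob_polys L T| + n`! * (n * q ^ n.-1))%N.
Proof.
move=> TJ; have sumT (U : {set 'S_n}) :
    (\sum_(s in U) #|frob_tuples L s| <= #|U| * q ^ n)%N.
  by rewrite -sum_nat_const; apply: leq_sum => s _; exact: card_frob_tuples.
split; first by rewrite card_frob_polys.
have all : (n`! * #|frob_polys L [set: 'S_n]| =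
    \sum_(s in T) #|frob_tuples L s| + \sum_(s in (~: T)%SET) #|frob_tuples L s|)%N.
  rewrite card_frob_polys; last by move=> s t _; rewrite finset.in_setT.
  by rewrite (bigID (mem T)) /=; congr (_ + _)%N; apply: eq_bigl => s; rewrite !inE.
have sep : (q ^ n <= #|frob_polys L [set: 'S_n]| + n * q ^ n.-1)%N.
  apply: leq_trans (_ : _ <= #|frob_polys L [set: 'S_n]| +
    #|[set c : n.-tuple k | ~~ separable_poly (monic_of_tuple c)]|)%N _; last first.
    by rewrite leq_add2l card_inseparable.
  rewrite -card_tuple -(cardC (mem (frob_polys L [set: 'S_n]))) leq_add2l.
  by apply/eq_leq/eq_card => c; rewrite [RHS]inE -(frob_polys_all splits).
have cT : (#|T| + #|(~: T)%SET| = n`!)%N by rewrite finset.cardsC card_Sn.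
rewrite -(card_frob_polys L TJ) in all.
have sep_fact : (n`! * q ^ n <=
    n`! * #|frob_polys L [set: 'S_n]| + n`! * (n * q ^ n.-1))%N.
  by rewrite -mulnDr leq_mul2l sep orbT.
rewrite all -{1}cT mulnDl in sep_fact.
have TC := sumT (~: T)%SET; lia.
Qed.

End Estimate.

(** * Discriminants and reduction *)

Section Discriminant.
Variables (A : comNzRingType) (k : fieldType) (h : {rmorphism A -> k}).

(* The degree of r may drop under h, so map_resultant does not apply. *)
Lemma map_resultant_neq0 (p r : {poly A}) : p \is monic ->
  coprimep (map_poly h p) (map_poly h r) -> h (resultant p r) != 0.
Proof.
move=> pm cop; have ph : map_poly h p \is monic by rewrite monic_map.
have sph : size (map_poly h p) = size p.
  by rewrite size_map_poly_id0 // (monicP pm) rmorph1 oner_eq0.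
have sp : size p = (size p).-1.+1.
  by rewrite prednK // size_poly_gt0 monic_neq0.
rewrite -det_map_mx /=; apply/det0P => -[u nz_u].
pose band m (s : {poly k}) : 'M[k]_(m, (size r).-1 + (size p).-1) :=
  lin1_mx (poly_rV \o s \o* rVpoly).
have -> : map_mx h (Sylvester_mx p r) =
    col_mx (band _ (map_poly h p)) (band _ (map_poly h r)).
  rewrite /Sylvester_mx map_col_mx; congr (col_mx _ _);
    by apply: map_lin1_mx => v; rewrite map_poly_rV rmorphM /= map_rVpoly.
rewrite -[u]hsubmxK -{1}row_mx0 mul_row_col !mul_rV_lin1 /= in nz_u *.
set v := rVpoly (lsubmx u); set w := rVpoly (rsubmx u).
have sv : (size v <= (size r).-1)%N by exact: size_poly.
have sw : (size w <= (size p).-1)%N by exact: size_poly.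
have sr : (size (map_poly h r) <= size r)%N by exact: size_poly.
move/(congr1 rVpoly)/eqP; rewrite -linearD linear0 poly_rV_K; last first.
  rewrite (leq_trans (size_polyD _ _)) // geq_max.
  rewrite !(leq_trans (size_polyMleq _ _)) //.
    rewrite -subn1 leq_subLR addnA addnC leq_add // add1n.
    exact: leq_trans sr (leqSpred _).
  by rewrite sph {1}sp addnS leq_add2r.
rewrite addr_eq0 => /eqP vw.
(* A kernel vector gives v p + w r = 0 after reduction. By coprimality p divides w, whose degree is
   smaller. *)
have w0 : w = 0.
  apply/eqP; apply: contraTT sw => w0; rewrite -ltnNge -sp.
  rewrite -sph dvdp_leq // -(Gauss_dvdpl _ cop) -[w * _]opprK -vw.
  by rewrite -mulNr dvdp_mull.
move/eqP: vw; rewrite w0 mul0r oppr0 mulf_eq0 (negPf (monic_neq0 ph)) orbF => v0.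
case/eqP: nz_u; congr row_mx; apply: (can_inj rVpolyK); rewrite linear0 -/v -/w //.
exact/eqP.
Qed.

(** The resultant is a combination of [f] and its derivative, so if its image is nonzero, no common
    factor survives reduction; the converse is [map_resultant_neq0]. *)
Lemma monic_disc_map_neq0 (f : {poly A}) (n : nat) :
  (1 < n)%N -> n%:R != 0 :> A -> f \is monic -> size f = n.+1 ->
  (h (monic_disc f) != 0) = separable_poly (map_poly h f).
Proof.
move=> n_gt1 nA fm sf; rewrite /monic_disc rmorphM /= mulf_eq0 rmorphXn rmorphN rmorph1.
rewrite signr_eq0 /= unlock deriv_map; apply/idP/idP; last exact: map_resultant_neq0.
(* The leading coefficient n of the derivative is nonzero in [A], even if it vanishes after
   reduction, so the derivative is not constant. *)
have f'n : (n.-1 < size f^`())%N.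
  rewrite ltnNge; apply/negP => /leq_sizeP/(_ _ (leqnn _)).
  have := monicP fm; rewrite lead_coefE sf coef_deriv prednK /=; last exact: ltnW.
  by move=> -> /eqP; rewrite (negPf nA).
have [||[u v] /= _ uv] := resultant_in_ideal (p := f) (q := f^`()).
- by rewrite sf ltnS ltnW.
- by rewrite (leq_trans _ f'n) // prednK // ltnW.
move=> res0; have /(congr1 (map_poly h)) := uv.
rewrite map_polyC rmorphD !rmorphM /= => {}uv.
apply/coprimepP => d d1 d2; rewrite -size_poly_eq1 -dvdp1.
have : d %| (h (resultant f f^`()))%:P by rewrite uv dvdp_add // dvdp_mull.
by rewrite -[_%:P]mulr1 mul_polyC dvdpZr.
Qed.
End Discriminant.

(** * Completeness and residue fields *)

(** The residue field comes only as a ring with a cardinality; the bijection supplies the finite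
    structure on the same carrier. *)
Lemma finField_of_bij (T : comNzRingType) (q : nat) (f : T -> 'I_q) :
  bijective f -> (forall x : T, x != 0 -> exists y, y * x = 1) ->
  exists (k : finFieldType) (h : {rmorphism T -> k}), bijective h /\ #|k| = q.
Proof.
case=> g fK gK inv_ex.
have inv_ex' (x : T) : exists y, (x != 0) ==> (y * x == 1).
  have [_|x0] := eqVneq x 0; first by exists 0.
  by have [y yx] := inv_ex x x0; exists y; rewrite yx eqxx.
have [inv1 inv1P] : exists inv1 : T -> T, forall x, x != 0 -> inv1 x * x = 1.
  exists (fun x => xchoose (inv_ex' x)) => x x0.
  exact/eqP/(implyP (xchooseP (inv_ex' x))).
pose inv (x : T) : T := if x == 0 then 0 else inv1 x.
have mulVx (x : T) : x != 0 -> inv x * x = 1.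
  by move=> x0; rewrite /inv (negPf x0) inv1P.
have inv0 : inv 0 = 0 by rewrite /inv eqxx.
have count_f := pcan_pickleK (can_pcan fK).
pose cT : countType := HB.pack_for countType T (isCountable.Build T count_f).
have enum_f := @pcan_enumP cT 'I_q f _ (can_pcan fK).
pose k : finFieldType := HB.pack_for finFieldType T
  (isCountable.Build T count_f) (fintype.isFinite.Build T enum_f)
  (GRing.ComNzRing_isField.Build T mulVx inv0).
exists k, (idfun : {rmorphism T -> k}); split; first by exists id.
by rewrite -[RHS]card_ord; exact: (@bij_eq_card k 'I_q f (Bijective fK gK)).
Qed.

Local Open Scope classical_set_scope.

Section Completeness.
Variables (R : realType).

Definition vabs_cauchy (K : fieldType) (v : nonarch_abs R K) (u : nat -> K) :=
  forall e : R, 0 < e -> exists N, forall m n, (N <= m)%N -> (N <= n)%N ->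
    v (u m - u n) < e.

Definition vabs_limit (K : fieldType) (v : nonarch_abs R K) (u : nat -> K) (l : K) :=
  forall e : R, 0 < e -> exists N, forall n, (N <= n)%N -> v (l - u n) < e.

Lemma vabs_gt0 (K : fieldType) (v : nonarch_abs R K) (x : K) : x != 0 -> 0 < v x.
Proof.
by move=> x0; rewrite lt_def vabs_ge0 andbT; apply: contraNneq x0 => /vabs_eq0 ->.
Qed.

Lemma padic_seq_complete (p : nat) (Qp : fieldType) (vp : nonarch_abs R Qp)
  (u : nat -> Qp) : is_padic_field p vp -> vabs_cauchy vp u ->
  exists l, vabs_limit vp u l.
Proof.
move=> [_ _ cpl] cu; pose w : nat -> valued vp := u.
have cw : cauchy (nbhs (w @ \oo)).
  apply: cauchy_exP => e e0; have [N NP] := cu e e0.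
  exists (w N); exists N => // n /= Nn.
  by rewrite /= ballEmdist /=; apply: NP.
have wl := cpl _ _ cw; set l := lim _ in wl.
exists l => e e0; have : nbhs (w @ \oo) (ball (l : valued vp) e).
  by apply: wl; apply: nbhsx_ballx.
case=> N _ NP; exists N => n Nn; have := NP n Nn.
by rewrite /= ballEmdist.
Qed.

Variables (Qp : fieldType) (vp : nonarch_abs R Qp) (K : fieldExtType Qp).
Variable v : nonarch_abs R K.
Hypothesis Qp_complete : forall u, vabs_cauchy vp u -> exists l, vabs_limit vp u l.
Hypothesis v_ext : forall x : Qp, v x%:A = vp x.

Lemma vabsZ (a : Qp) (x : K) : v (a *: x) = vp a * v x.
Proof. by rewrite -mulr_algl vabsM v_ext. Qed.

Definition vabs_complete (W : {vspace K}) := forall u, (forall n, u n \in W) ->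
  vabs_cauchy v u -> exists2 l, l \in W & vabs_limit v u l.

(** A complete subspace is closed: at distance 0 from [x], some sequence in [W] would converge both
    to [x] and to a point of [W]. *)
Lemma vabs_distance_gt0 (W : {vspace K}) (x : K) : vabs_complete W -> x \notin W ->
  exists2 d : R, 0 < d & forall w, w \in W -> d <= v (x - w).
Proof.
move=> cW xW; apply: contrapT => nd.
have /choice[w wP] n : exists w, w \in W /\ v (x - w) < n.+1%:R^-1.
  apply: contrapT => nw; apply: nd; exists n.+1%:R^-1; first by rewrite invr_gt0.
  by move=> w wW; rewrite leNgt; apply/negP => xw; apply: nw; exists w.
have wx e : 0 < e -> exists N, forall n, (N <= n)%N -> v (x - w n) < e.
  move=> e0; exists (Num.truncn e^-1) => n Nn.
  apply: lt_le_trans (wP n).2 _; rewrite invf_ple ?posrE //.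
  apply: le_trans (ltW (truncnS_gt _)) _.
  by rewrite ler_nat ltnS.
have cw : vabs_cauchy v w.
  move=> e e0; have [N NP] := wx e e0; exists N => m n Nm Nn.
  rewrite -(subrKA x); apply: le_lt_trans (vabs_ultra _ _ _) _.
  by rewrite gt_max NP // nabs_distC NP.
have [l lW wl] := cW w (fun n => (wP n).1) cw.
case/negP: xW; suff -> : x = l by [].
apply: (@nabs_dist0 R K v); apply/eqP; rewrite eq_le vabs_ge0 andbT leNgt.
apply/negP => e0; have [N1 N1P] := wx _ e0; have [N2 N2P] := wl _ e0.
have /N1P := leq_maxl N1 N2; have /N2P := leq_maxr N1 N2.
set m := maxn _ _ => lm xm; have := vabs_ultra v (x - w m) (w m - l).
rewrite subrKA [v (w m - l)]nabs_distC => /le_lt_trans h.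
by have := h (v (x - l)); rewrite gt_max xm lm ltxx => /(_ isT).
Qed.

(** By induction on the generators, the coefficients along a new vector [x] and the remainders in
    the old span form two Cauchy sequences. *)
Lemma span_complete (X : seq K) : vabs_complete <<X>>%VS.
Proof.
elim: X => [|x X IHX] u uX cu.
  exists 0; first exact: mem0v.
  move=> e e0; exists 0%N => n _; have := uX n.
  by rewrite span_nil memv0 => /eqP ->; rewrite subrr nabs0.
have [xX|xX] := boolP (x \in <<X>>%VS).
  have eX : <<x :: X>>%VS = <<X>>%VS by rewrite span_cons; apply/addv_idPr.
  rewrite eX in uX *; exact: IHX.
have [d d0 dP] := vabs_distance_gt0 IHX xX.
have /choice[c cP] n : exists c, u n - c *: x \in <<X>>%VS.
  have := uX n; rewrite span_cons => /memv_addP[_ /vlineP[c ->] [w wX ->]].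
  by exists c; rewrite addrC addKr.
(* The positive distance [d] from [x] to the old span controls the coefficient of [x] by the size of
   the whole vector. *)
have vcx a w : w \in <<X>>%VS -> vp a * d <= v (a *: x + w).
  move=> wX; have [->|a0] := eqVneq a 0; first by rewrite nabs0 mul0r vabs_ge0.
  have -> : a *: x + w = a *: (x - (- (a^-1 *: w))).
    by rewrite opprK scalerDr scalerA divff // scale1r.
  by rewrite vabsZ ler_wpM2l ?vabs_ge0 // dP // rpredN rpredZ.
have cc : vabs_cauchy vp c.
  move=> e e0; have [N NP] := cu (e * d) (mulr_gt0 e0 d0); exists N => m n Nm Nn.
  rewrite -(ltr_pM2r d0); apply: le_lt_trans (NP m n Nm Nn).
  have -> : u m - u n = (c m - c n) *: x + ((u m - c m *: x) - (u n - c n *: x)).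
    by rewrite scalerBl; ring.
  by apply: vcx; rewrite rpredB.
have [c0 c0P] := Qp_complete cc.
have cw : vabs_cauchy v (fun n => u n - c n *: x).
  move=> e e0; have x0 : 0 < v x.
    by rewrite vabs_gt0 //; apply: contraNneq xX => ->; rewrite mem0v.
  have [N1 N1P] := cu e e0; have [N2 N2P] := cc (e / v x) (divr_gt0 e0 x0).
  exists (maxn N1 N2) => m n; rewrite !geq_max => /andP[m1 m2] /andP[n1 n2].
  have -> : u m - c m *: x - (u n - c n *: x) = (u m - u n) + (c n - c m) *: x.
    by rewrite scalerBl; ring.
  apply: le_lt_trans (vabs_ultra _ _ _) _; rewrite gt_max N1P //= vabsZ.
  by rewrite -ltr_pdivlMr // N2P.
have [w0 w0X w0P] := IHX _ cP cw.
exists (c0 *: x + w0).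
  by rewrite span_cons memv_add // memvZ ?memv_line.
move=> e e0; have x0 : 0 < v x.
  by rewrite vabs_gt0 //; apply: contraNneq xX => ->; rewrite mem0v.
have [N1 N1P] := w0P e e0; have [N2 N2P] := c0P (e / v x) (divr_gt0 e0 x0).
exists (maxn N1 N2) => n; rewrite geq_max => /andP[n1 n2].
have -> : c0 *: x + w0 - u n = (c0 - c n) *: x + (w0 - (u n - c n *: x)).
  by rewrite scalerBl; ring.
apply: le_lt_trans (vabs_ultra _ _ _) _; rewrite gt_max N1P // andbT vabsZ.
by rewrite -ltr_pdivlMr // N2P.
Qed.

Lemma extension_seq_complete (u : nat -> K) : vabs_cauchy v u ->
  exists l, vabs_limit v u l.
Proof.
move=> cu; have [n|l _ lu] := span_complete (X := vbasis {:K}) _ cu.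
  by rewrite (span_basis (vbasisP _)) memvf.
by exists l.
Qed.

End Completeness.

Section IntegerRing.
Variables (R : realType) (K : fieldType) (v : nonarch_abs R K).
Local Notation O := (integers v).

Lemma int_val_total (x : K) :
  (exists a : O, val a = x) \/ (exists2 a : O, val a = x^-1 & a \in max_ideal v).
Proof.
have [vx|vx] := lerP (v x) 1; first by left; exists (@Integer R K v x vx).
have x0 : x != 0 by apply: contraTneq vx => ->; rewrite nabs0 ltr10.
have vVx : v x^-1 < 1.
  have vx0 := vabs_gt0 v x0; rewrite -(ltr_pM2l vx0) -vabsM divff // nabs1.
  by rewrite mulr1.
right; exists (@Integer R K v x^-1 (ltW vVx)); [by [] | exact: vVx].
Qed.

Lemma vabsX (x : K) m : v (x ^+ m) = v x ^+ m.
Proof. by elim: m => [|m IHm]; rewrite ?expr0 ?nabs1 // !exprS vabsM IHm. Qed.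

Lemma geometric_small (z e : R) : 0 <= z < 1 -> 0 < e ->
  exists N, forall n, (N <= n)%N -> z ^+ n < e.
Proof.
move=> /andP[z0 z1] e0; have /cvgrPdist_lt/(_ _ e0) : (fun n => z ^+ n) @ \oo --> (0 : R).
  by apply: cvg_expr; rewrite ger0_norm.
case=> N _ NP; exists N => n /NP /=.
by rewrite sub0r normrN ger0_norm // exprn_ge0.
Qed.

Lemma int_cadic_separated (c : O) : c \in max_ideal v -> cadic_separated c.
Proof.
move=> c1 a aP; apply/val_inj/(@vabs_eq0 R K v)/eqP.
rewrite eq_le vabs_ge0 andbT leNgt; apply/negP => a0.
have c01 : 0 <= v (val c) < 1 by rewrite vabs_ge0.
have [N /(_ N (leqnn N))] := geometric_small c01 a0.
have [b ab] := aP N; rewrite {1}ab rmorphM rmorphXn /= vabsM vabsX.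
rewrite ltNge ler_piMr ?exprn_ge0 ?vabs_ge0 //; exact: int_valP.
Qed.

Lemma int_cadic_complete (c : O) :
  (forall u, vabs_cauchy v u -> exists l, vabs_limit v u l) ->
  c \in max_ideal v -> cadic_complete c.
Proof.
move=> cplK c1 s sP; pose u n := val (s n).
have c01 : 0 <= v (val c) < 1 by rewrite vabs_ge0.
have uP m j : v (u (m + j)%N - u m) <= v (val c) ^+ m.
  elim: j => [|j IHj]; first by rewrite addn0 subrr nabs0 exprn_ge0 ?vabs_ge0.
  have [r sr] := sP (m + j)%N; rewrite addnS -(subrKA (u (m + j)%N)).
  apply: le_trans (vabs_ultra _ _ _) _; rewrite ge_max IHj andbT /u sr.
  rewrite rmorphD rmorphM rmorphXn /= addrC addKr vabsM vabsX.
  apply: le_trans (_ : v (val c) ^+ (m + j) <= _).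
    by rewrite ler_piMr ?exprn_ge0 ?vabs_ge0 //; exact: int_valP.
  by rewrite exprD ler_piMr ?exprn_ge0 ?vabs_ge0 ?exprn_ile1 ?vabs_ge0 // ltW.
have cu : vabs_cauchy v u.
  move=> e e0; have [N NP] := geometric_small c01 e0; exists N => m n Nm Nn.
  rewrite -(subrKA (u N)); apply: le_lt_trans (vabs_ultra _ _ _) _.
  rewrite gt_max [v (u N - _)]nabs_distC.
  by rewrite -(subnKC Nm) -(subnKC Nn) !(le_lt_trans (uP _ _)) // NP.
have [l ul] := cplK u cu.
have lP m : v (l - u m) <= v (val c) ^+ m.
  rewrite leNgt; apply/negP => lm.
  have lm0 : 0 < v (l - u m) by apply: le_lt_trans lm; rewrite exprn_ge0 ?vabs_ge0.
  have [N /(_ _ (leq_addl m N))] := ul _ lm0; rewrite ltNge => /negP; apply.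
  apply: contraT; rewrite -ltNge => lt1.
  have := vabs_ultra v (l - u (m + N)%N) (u (m + N)%N - u m).
  by rewrite subrKA leNgt gt_max lt1 (le_lt_trans (uP _ _) lm).
have l1 : v l <= 1.
  have := lP 0%N; rewrite expr0 => l0; rewrite -(subrK (u 0%N) l).
  by apply: le_trans (vabs_ultra _ _ _) _; rewrite ge_max l0; exact: int_valP.
(* If c^m = 0 the bound forces l = s m; otherwise the quotient of l - s m by c^m is integral. *)
exists (@Integer R K v l l1) => m; have [c0|c0] := eqVneq (val (c ^+ m)) 0.
  exists 0; rewrite mulr0 addr0; apply: val_inj; apply: (@nabs_dist0 R K v).
  apply/eqP; rewrite eq_le vabs_ge0 andbT -(nabs0 v) -c0 rmorphXn /= vabsX.
  exact: lP.
have r1 : v ((l - u m) / val (c ^+ m)) <= 1.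
  rewrite -(ler_pM2r (vabs_gt0 v c0)) -vabsM divfK // mul1r rmorphXn /= vabsX.
  exact: lP.
exists (@Integer R K v _ r1); apply: val_inj.
by rewrite rmorphD rmorphM /= mulrC divfK // addrC subrK.
Qed.

Lemma residue_finField (q : nat) : ([set: residue_field v] #= `I_q)%card ->
  exists (k : finFieldType) (red : {rmorphism O -> k}),
   [/\ forall y, exists a, red a = y, forall a, (red a == 0) = (a \in max_ideal v)
     & #|k| = q].
Proof.
move=> /card_set_bijP[f [f_fun f_inj f_surj]].
have f_lt x : (f x < q)%N by exact: f_fun.
pose F x := Ordinal (f_lt x).
have F_bij : bijective F.
  have /choice[g gP] (i : 'I_q) : exists x, f x = i.
    by have [x _ fx] := f_surj i (ltn_ord i); exists x.
  exists g => [x|i]; last by apply: val_inj; rewrite /= gP.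
  by apply: f_inj; rewrite ?inE // gP.
have pi0 (a : O) : ((\pi_(residue_field v) a)%qT == 0) = (a \in max_ideal v).
  by rewrite -[a in RHS]subr0 Quotient.idealrBE raddf0.
(* An integer outside the maximal ideal has absolute value 1, so its inverse is an integer. *)
have inv_ex (x : residue_field v) : x != 0 -> exists y, y * x = 1.
  rewrite -[x]reprK; move: (repr x) => a; rewrite pi0 unfold_in -leNgt => a1.
  have va : v (val a) = 1 by apply/eqP; rewrite eq_le a1 andbT; exact: int_valP.
  have a0 : val a != 0 by apply: contra_eq_neq va => ->; rewrite nabs0 eq_sym oner_neq0.
  have vb : v (val a)^-1 <= 1.
    by rewrite -(mul1r (v _)) -va -vabsM divff // nabs1.
  exists (\pi_(residue_field v) (@Integer R K v _ vb))%qT.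
  rewrite -rmorphM /= (_ : _ * _ = 1) ?rmorph1 //; apply: val_inj.
  by rewrite rmorphM rmorph1 /= mulVf.
have [k [h [hbij kq]]] := finField_of_bij F_bij inv_ex.
pose red : {rmorphism O -> k} := h \o (\pi_(residue_field v))%qT.
exists k, red; split=> // [y|a].
  have [g _ gK] := hbij; exists (repr (g y)).
  by rewrite /red /= reprK gK.
by rewrite -pi0 -[in RHS](inj_eq (bij_inj hbij)) rmorph0.
Qed.

End IntegerRing.

(** * Measures of residue cylinders *)

Section FinitePartition.
Context d (T : measurableType d) (R : realType) (I : finType).
Variables (mu : {measure set T -> \bar R}) (g : T -> I) (A : {set I}).
Hypothesis mg : forall i, measurable [set x | g x = i].

Lemma fiber_bigcup : [set x | g x \in A] =
  \bigcup_(i in [set` enum A]) [set x | g x = i].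
Proof.
apply/seteqP; split=> [x /= gA|x [i /= iA gx]]; last by rewrite gx -mem_enum.
by exists (g x) => //=; rewrite mem_enum.
Qed.

Lemma measure_fiber (c : R) : (forall i, mu [set x | g x = i] = c%:E) ->
  mu [set x | g x \in A] = (#|A|%:R * c)%:E.
Proof.
move=> muc; rewrite fiber_bigcup measure_fin_bigcup //.
- rewrite -fsbig_seq ?enum_uniq //.
  rewrite (eq_bigr (fun=> c%:E)) => [|i _]; last exact: muc.
  by rewrite sumEFin big_enum /= sumr_const mulr_natl.
- by move=> i j _ _ [x [/= -> ->]].
Qed.

End FinitePartition.

Section ResidueMeasure.
Variables (R : realType) (K : fieldType) (v : nonarch_abs R K).
Local Notation O := (integers v).
Variables (k : finFieldType) (red : {rmorphism O -> k}).
Hypothesis red_surj : forall y, exists a, red a = y.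
Hypothesis red_eq0 : forall a, (red a == 0) = (a \in max_ideal v).

(** The class contains the open ball of radius 1 around each of its points, hence is open. *)
Lemma measurable_residue_class (y : k) : measurable [set a : O | red a = y].
Proof.
apply: sub_sigma_algebra; rewrite /= openE => a /= ya.
apply/nbhs_ballP; exists 1 => //= b; rewrite ballEmdist /= => ab.
apply/eqP; rewrite -ya eq_sym -subr_eq0 -rmorphB red_eq0 unfold_in rmorphB.
exact: ab.
Qed.

Variable h : probability O R.
Hypothesis haar_h : is_haar h.

(** The q residue classes are translates of one another and partition a space of mass 1. *)
Lemma haar_residue_class (y : k) : h [set a : O | red a = y] = (#|k|%:R^-1)%:E.
Proof.
have hy z : h [set a : O | red a = z] = h [set a : O | red a = 0].
  have [b bz] := red_surj z.
  rewrite -(haar_h b (measurable_residue_class 0)); congr (h _).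
  apply/seteqP; split=> [a /= az|_ [a /= a0 <-]]; last first.
    by rewrite /= rmorphD a0 addr0.
  by exists (a - b); rewrite /= ?rmorphB ?az ?bz ?subrr // addrC subrK.
have h0 : h [set a : O | red a = 0] \is a fin_num.
  by rewrite fin_num_measure //; exact: measurable_residue_class.
have := @measure_fiber _ _ _ _ h red [set: k] measurable_residue_class _
  (fun z => etrans (hy z) (esym (fineK h0))).
have -> : [set x | red x \in [set: k]%SET] = setT.
  by apply/seteqP; split=> // x _; rewrite /= finset.in_setT.
move=> hT; have := etrans (esym hT) (probability_setT h).
rewrite cardsT => -[k1]; rewrite hy -(fineK h0); congr (_%:E).
have k0 : #|k|%:R != 0 :> R.
  by rewrite pnatr_eq0 -lt0n (ltn_trans _ (finNzRing_gt1 k)).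
by apply: (mulfI k0); rewrite k1 divff.
Qed.

Lemma map_tuple_fiber n (c : n.-tuple k) :
  [set a : n.-tuple O | map_tuple red a = c] =
  \bigcap_(i in [set: 'I_n]) [set a : n.-tuple O | red (tnth a i) = tnth c i].
Proof.
apply/seteqP; split=> [a /= <- i _ /=|a /= ac]; first by rewrite tnth_map.
by apply: eq_from_tnth => i; rewrite tnth_map; exact: ac.
Qed.

Lemma measurable_residue_cylinder n (c : n.-tuple k) :
  measurable [set a : n.-tuple O | map_tuple red a = c].
Proof.
rewrite map_tuple_fiber; apply: fin_bigcap_measurable => // i _.
rewrite -[X in measurable X]setTI.
have := @measurable_tnth _ O n i measurableT _ (measurable_residue_class (tnth c i)).
exact.
Qed.

Lemma power_measure_residue_cylinder n (c : n.-tuple k) :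
  power_measure h n [set a : n.-tuple O | map_tuple red a = c] =
  (#|k|%:R ^- n)%:E.
Proof.
elim: n c => [|n IHn] c.
  rewrite /= diracE mem_set ?expr0 ?invr1 //=.
  by rewrite [c]tuple0; exact: tuple0.
rewrite /= /distribution /pushforward /=.
transitivity ((h \x power_measure h n)%E ([set a : O | red a = thead c] `*`
    [set a : n.-tuple O | map_tuple red a = [tuple of behead c]])).
  congr (_ _); apply/seteqP; split=> [[a b] /= abc|[a b] /= [ac bc]].
    by rewrite -abc; split => //; apply: val_inj.
  rewrite (tuple_eta c); apply: val_inj => /=.
  by rewrite ac; have /(congr1 val)/= -> := bc.
rewrite product_measure1E;
  [|exact: measurable_residue_class|exact: measurable_residue_cylinder].
apply: etrans (congr2 (fun x y => x * y)%E (haar_residue_class _) (IHn _)) _.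
by rewrite -EFinM exprS invfM.
Qed.

Lemma power_measure_residue n (C : {set n.-tuple k}) :
  power_measure h n [set a : n.-tuple O | map_tuple red a \in C] =
  (#|C|%:R / #|k|%:R ^+ n)%:E.
Proof.
exact: (@measure_fiber _ _ _ _ (power_measure h n) (map_tuple red) C
  (@measurable_residue_cylinder n) _ (@power_measure_residue_cylinder n)).
Qed.

End ResidueMeasure.

(** * The distribution of Galois groups *)

Section ResidueCriterion.
Variables (R : realType) (K : fieldType) (v : nonarch_abs R K).
Local Notation O := (integers v).
Variables (k : finFieldType) (red : {rmorphism O -> k}).
Hypothesis red_surj : forall y, exists a, red a = y.
Hypothesis red_eq0 : forall a, (red a == 0) = (a \in max_ideal v).
Hypothesis K_complete : forall u, vabs_cauchy v u -> exists l, vabs_limit v u l.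
Variables (n : nat) (L : fieldExtType k) (G : {group 'S_n}).
Hypotheses (n_gt1 : (1 < n)%N) (n_neq0 : n%:R != 0 :> O).
Hypothesis splits : forall c : n.-tuple k,
  exists x : {ffun 'I_n -> finvect_type L},
    map_poly (in_alg (finvect_type L)) (monic_of_tuple c) =
    \prod_i ('X - (x i)%:P).

Definition conj_generators : {set 'S_n} :=
  [set s : 'S_n | [exists t : 'S_n, <[s]>%g == (G :^ t)%g]]%SET.

Lemma conj_generatorsJ s t :
  s \in conj_generators -> (s ^ t)%g \in conj_generators.
Proof.
rewrite !inE => /existsP[u /eqP su]; apply/existsP; exists (u * t)%g.
by rewrite cycleJ su conjsgM.
Qed.

(** Both conditions depend only on the reduction: the discriminant through separability, the Galois
    group through the Frobenius permutation of any ordering of the residual roots. *)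
Lemma Pstar_frob_polys :
  Pstar v G = [set a | map_tuple red a \in frob_polys L conj_generators].
Proof.
have total x : (exists a : O, val a = x) \/ (exists2 a : O, val a = x^-1 & red a = 0).
  have [|[a aE am]] := int_val_total v x; [by left | right].
  by exists a => //; apply/eqP; rewrite red_eq0.
have cadic (c : O) : red c = 0 -> cadic_separated c /\ cadic_complete c.
  move=> /eqP; rewrite red_eq0 => cm.
  by split; [exact: int_cadic_separated | exact: int_cadic_complete].
have disc (a : n.-tuple O) : (monic_disc (monic_of_tuple a) \notin max_ideal v) =
    (map_tuple red a \in frob_polys L [set: 'S_n]%SET).
  rewrite -red_eq0 (monic_disc_map_neq0 _ n_gt1) ?monic_of_tuple_monic
    ?size_monic_of_tuple //.
  by rewrite map_monic_of_tuple (frob_polys_all splits).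
have gal (a : n.-tuple O) x s : x \in frob_tuples L s ->
    map_poly (in_alg (finvect_type L)) (monic_of_tuple (map_tuple red a)) =
      \prod_i ('X - (x i)%:P) ->
    has_galois_group (map_poly val (monic_of_tuple a)) G <->
      s \in conj_generators.
  case/frob_tuplesP=> xi xs fx; rewrite inE.
  rewrite (has_galois_group_frobenius red_surj val_inj total cadic
    (kk := finvect_type L) (x := x) (sigma := s) G) ?monic_of_tuple_monic //.
    by split=> [[t st]|/existsP[t /eqP st]]; [apply/existsP; exists t; apply/eqP | exists t].
  by rewrite map_poly_comp map_monic_of_tuple.
apply/seteqP; split=> a /=; rewrite /Pstar /= disc.
  move=> [/frob_polysP[x [s [_ xs fx]]] /(gal _ _ _ xs fx) sG].
  by apply/frob_polysP; exists x, s.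
case/frob_polysP=> x [s [sG xs fx]]; split; last exact/(gal _ _ _ xs fx).
by apply/frob_polysP; exists x, s; split=> //; rewrite finset.in_setT.
Qed.

End ResidueCriterion.

Lemma padic_natr_neq0 (R : realType) (p : nat) (Qp : fieldType)
    (vp : nonarch_abs R Qp) n : prime p -> is_padic_field p vp -> (0 < n)%N ->
  n%:R != 0 :> Qp.
Proof.
move=> p_pr [vrat _ _] n_gt0; have := vrat n%:R.
rewrite ratr_nat /padic_abs pnatr_eq0 (gtn_eqF n_gt0) => vn.
apply: contra_eq_neq vn => ->; rewrite nabs0 eq_sym expfz_eq0 negb_and.
by rewrite pnatr_eq0 -lt0n prime_gt0 ?orbT.
Qed.

(** With F = n! and b = |T|, dividing the counting bounds by n! q^n leaves an error of at most
    n/q. *)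
Lemma frob_ratio_dist (R : realFieldType) (a b n q F : nat) :
  (0 < n)%N -> (0 < q)%N -> (0 < F)%N ->
  (F * a <= b * q ^ n)%N -> (b * q ^ n <= F * a + F * (n * q ^ n.-1))%N ->
  `|a%:R / q%:R ^+ n - b%:R / F%:R| <= n%:R / q%:R :> R.
Proof.
case: n => // n _ q0 F0; rewrite -!(ler_nat R) !(natrD, natrM, natrX) /= => le1 le2.
have {}q0 : 0 < q%:R :> R by rewrite ltr0n.
have {}F0 : 0 < F%:R :> R by rewrite ltr0n.
have Q0 : 0 < q%:R ^+ n.+1 :> R by rewrite exprn_gt0.
have -> : a%:R / q%:R ^+ n.+1 - b%:R / F%:R =
    (F%:R * a%:R - b%:R * q%:R ^+ n.+1) / (q%:R ^+ n.+1 * F%:R) :> R.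
  by field; rewrite !gt_eqF.
have -> : n.+1%:R / q%:R = F%:R * (n.+1%:R * q%:R ^+ n) / (q%:R ^+ n.+1 * F%:R) :> R.
  by rewrite exprS; field; rewrite !gt_eqF ?exprn_gt0.
rewrite normrM (ger0_norm (_ : 0 <= _^-1)); last by rewrite invr_ge0 ltW ?mulr_gt0.
rewrite ler_pM2r; last by rewrite invr_gt0 mulr_gt0.
by rewrite ler0_norm ?subr_le0 // opprB lerBlDl.
Qed.

Lemma erdos_turan_conj_generators (R : realType) (n : nat) (G : {group 'S_n}) :
  erdos_turan R G = #|conj_generators G|%:R / n`!%:R.
Proof.
rewrite /conj_generators -card_cycle_class_generator /erdos_turan.
by case: pickP => // _; rewrite mul0r.
Qed.

Theorem theorem1p5 (R : realType) (n : nat) (n_ge2 : (2 <= n)%N)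
    (G : {group 'S_n}) (eps : R) (eps_gt0 : 0 < eps) :
  exists q0 : nat,
  forall (p : nat), prime p ->
  forall (Qp : fieldType) (vp : nonarch_abs R Qp), is_padic_field p vp ->
  forall (K : fieldExtType Qp) (v : nonarch_abs R K),
    (forall x : Qp, v x%:A = vp x) ->
  forall q : nat, ([set: residue_field v] #= `I_q)%card -> (q0 <= q)%N ->
  forall h : probability (integers v) R, is_haar h ->
  (`| power_measure h n (Pstar v G) - (erdos_turan R G)%:E | < eps%:E)%E.
Proof.
(* This threshold exceeds n/eps, so the error n/q is below eps. *)
exists (Num.truncn (n%:R / eps)).+1.
move=> p p_pr Qp vp Qp_padic K v v_ext q card_q q0q h haar_h.
have n_gt0 : (0 < n)%N by exact: ltnW.
have K_complete u := extension_seq_complete (u := u)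
  (fun w => padic_seq_complete Qp_padic) v_ext.
have [k [red [red_surj red_eq0 k_q]]] := residue_finField card_q.
have [L splits] := splitting_extension k n.
have n_neq0 : n%:R != 0 :> integers v.
  rewrite -(inj_eq val_inj) rmorph_nat rmorph0 -(rmorph_nat (in_alg K)) fmorph_eq0.
  exact: padic_natr_neq0 p_pr Qp_padic n_gt0.
rewrite (Pstar_frob_polys red_surj red_eq0 K_complete G n_ge2 n_neq0 splits).
rewrite (power_measure_residue red_surj red_eq0 haar_h) erdos_turan_conj_generators.
have [le1 le2] := frob_polys_bounds splits (@conj_generatorsJ n G).
have k_gt0 : (0 < #|k|)%N by rewrite (ltn_trans _ (finNzRing_gt1 k)).
rewrite -EFinB /= lte_fin.
apply: le_lt_trans (frob_ratio_dist R n_gt0 k_gt0 (fact_gt0 n) le1 le2) _.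
rewrite ltr_pdivrMr ?ltr0n // mulrC -ltr_pdivrMr // k_q.
apply: lt_le_trans (truncnS_gt _) _.
by rewrite ler_nat.
Qed.
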